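(* Let $\mathcal{G}=(\mathcal{V},\mathcal{E})$ be a strongly connected directed graph with $\mathcal{V}=\{1,\ldots,n\}$, $n\ge 2$, with in-Laplacian $\mathcal{L}_{in}$ and out-Laplacian $\mathcal{L}_{out}$, and for $\varepsilon\in\mathbb{R}$ let $$M(\varepsilon)=\begin{bmatrix} -\mathcal{L}_{in} & \varepsilon I\\ \mathcal{L}_{in} & -\mathcal{L}_{out}-\varepsilon I\end{bmatrix}\in\mathbb{R}^{2n\times 2n}.$$ Let $\bar\delta=\max_{i\in\mathcal{V}}\{\delta_{i,in},\delta_{i,out}\}$, let $\lambda_3(0)$ be a non-null eigenvalue of $M(0)$ with largest real part (the rightmost non-null eigenvalue), and let $$\tilde\tau=\frac{1}{2\bar\delta}\arctan\left(\frac{|\Re\{\lambda_3(0)\}|}{\bar\delta}\right).$$ Then there exists $\tilde\varepsilon>0$ such that, for every $\varepsilon\in(0,\tilde\varepsilon]$ and every $\tau>0$ with $\tau<\tilde\tau$, the solution $x(t),z(t)\in\mathbb{R}^n$ of the delayed system $$\begin{bmatrix}\dot x(t)\\ \dot z(t)\end{bmatrix}=M(\varepsilon)\begin{bmatrix}x(t-\tau)\\ z(t-\tau)\end{bmatrix},\quad t\ge 0,$$ with initial condition $x(\theta)=x(0)$, $z(\theta)=z(0)=\mathbf{0}_n$ for $-\tau\le\theta\le 0$, where $x(0)\in\mathbb{R}^n$ is arbitrary, satisfies $$\lim_{t\to\infty}x(t)=\frac{\mathbf{1}_n^Tx(0)}{n}\mathbf{1}_n.$$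
   Context: $\mathcal{E}\subseteq\mathcal{V}\times\mathcal{V}$; $(i,j)\in\mathcal{E}$ means node $i$ receives information from node $j$. The adjacency matrix is $A=[a_{ij}]$ with $a_{ij}=1$ if $(i,j)\in\mathcal{E}$ and $a_{ij}=0$ otherwise. The in-neighbors and out-neighbors of node $i$ are $\mathcal{N}_{i,in}=\{j\in\mathcal{V}:(i,j)\in\mathcal{E}\}$ and $\mathcal{N}_{i,out}=\{j\in\mathcal{V}:(j,i)\in\mathcal{E}\}$; the in-degree and out-degree are $\delta_{i,in}=|\mathcal{N}_{i,in}|$ and $\delta_{i,out}=|\mathcal{N}_{i,out}|$. With $D_{in}=\mathrm{diag}(\delta_{1,in},\ldots,\delta_{n,in})$ and $D_{out}=\mathrm{diag}(\delta_{1,out},\ldots,\delta_{n,out})$, define $\mathcal{L}_{in}=D_{in}-A$ and $\mathcal{L}_{out}=D_{out}-A$. $\mathcal{G}$ is strongly connected if there is a directed path connecting any ordered pair of nodes. $I$ is the $n\times n$ identity matrix; $\mathbf{1}_n$ and $\mathbf{0}_n$ are the vectors of $n$ ones and $n$ zeros. For strongly connected $\mathcal{G}$, the eigenvalues of $M(0)$ (those of $-\mathcal{L}_{in}$ and $-\mathcal{L}_{out}$ together) are ordered as $0=\lambda_1(0)=\lambda_2(0)>\Re(\lambda_3(0))\ge\cdots\ge\Re(\lambda_{2n}(0))$. The system is the matrix form, with a uniform delay $\tau$ on all states, of the protocol in which each agent $i$ has a state $x_i\in\mathbb{R}$ and a storage variable $z_i\in\mathbb{R}$ with undelayed update $$\dot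 x_i=-\sum_{j\in\mathcal{N}_{i,in}}(x_i-x_j)+\varepsilon z_i,\qquad \dot z_i=\sum_{j\in\mathcal{N}_{i,in}}(x_i-x_j)-\sum_{j\in\mathcal{N}_{i,in}}(z_i-z_j)-(\varepsilon-\delta_{i,in}+\delta_{i,out})z_i.$$ *)

(* Defs.v *)
From HB Require Import structures.
From mathcomp Require Import all_boot all_order all_algebra.
From mathcomp Require Import all_classical all_reals all_analysis.
From mathcomp Require Import complex.

Set Implicit Arguments.
Unset Strict Implicit.
Unset Printing Implicit Defensive.

Import Order.TTheory GRing.Theory Num.Theory.
Import numFieldNormedType.Exports.

Local Open Scope classical_set_scope.
Local Open Scope ring_scope.

(* A directed graph on n nodes is its edge relation: E i j means that (i, j) is
   an edge, i.e. that node i receives information from node j. Self-loops are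
   allowed; they cancel in both Laplacians. *)

Definition strongly_connected (n : nat) (E : rel 'I_n) : Prop :=
  forall i j : 'I_n, connect E i j.

Definition in_degree (n : nat) (E : rel 'I_n) (i : 'I_n) : nat :=
  #|[set j : 'I_n | E i j]%SET|.

Definition out_degree (n : nat) (E : rel 'I_n) (i : 'I_n) : nat :=
  #|[set j : 'I_n | E j i]%SET|.

Definition max_degree (n : nat) (E : rel 'I_n) : nat :=
  \max_(i < n) maxn (in_degree E i) (out_degree E i).

Definition adjacency (R : realType) (n : nat) (E : rel 'I_n) : 'M[R]_n :=
  \matrix_(i, j) (E i j)%:R.

Definition in_laplacian (R : realType) (n : nat) (E : rel 'I_n) : 'M[R]_n :=
  diag_mx (\row_i (in_degree E i)%:R) - adjacency R E.

Definition out_laplacian (R : realType) (n : nat) (E : rel 'I_n) : 'M[R]_n :=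
  diag_mx (\row_i (out_degree E i)%:R) - adjacency R E.

Definition system_matrix (R : realType) (n : nat) (E : rel 'I_n) (eps : R) :
    'M[R]_(n + n) :=
  block_mx (- in_laplacian R E) eps%:M
           (in_laplacian R E)   (- out_laplacian R E - eps%:M).

Definition is_rightmost_nonnull_eigenvalue (R : realType) (m : nat)
    (A : 'M[R]_m) (lambda : R[i]) : Prop :=
  let AC := map_mx (real_complex R) A in
  [/\ eigenvalue AC lambda, lambda != 0 &
      forall mu : R[i], eigenvalue AC mu -> mu != 0 ->
        complex.Re mu <= complex.Re lambda].

Definition tau_tilde (R : realType) (n : nat) (E : rel 'I_n) (lambda : R[i]) :
    R :=
  let dbar : R := (max_degree E)%:R in
  1 / (2 * dbar) * atan (`|complex.Re lambda| / dbar).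

(* y solves y'(t) = A y(t - tau) for t >= 0. At t = 0 the derivative is the
   right one: with a constant history the left derivative there is 0, so a
   two-sided derivative would exist only if A y(-tau) = 0. Only the values of y
   on [-tau, +oo[ are constrained; differentiability gives continuity of y
   on [0, +oo[ (from the right at 0). *)
Definition solves_delay_system (R : realType) (m : nat) (A : 'M[R]_m) (tau : R)
    (y : R -> 'cV[R]_m) : Prop :=
  h^-1 *: (y h - y 0) @[h --> 0^'+] --> A *m y (- tau) /\
  (forall t : R, 0 < t -> is_derive t 1 y (A *m y (t - tau))).

(* Main.v *)
Require Import Defs.
From mathcomp Require Import all_boot all_order all_algebra.
From mathcomp Require Import all_classical all_reals all_analysis.
From mathcomp Require Import complex.
From mathcomp Require Import ring lra.

Set Implicit Arguments.
Unset Strict Implicit.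
Unset Printing Implicit Defensive.

Import Order.TTheory GRing.Theory Num.Theory.
Import numFieldNormedType.Exports.
Import ComplexField.Normc.

Local Open Scope classical_set_scope.
Local Open Scope ring_scope.
Local Open Scope complex_scope.

(** Why the theorem holds.

    The columns of [system_matrix] sum to 0, so the sum of all entries of (x, z)
    is conserved, and for eps > 0 the right kernel is spanned by the consensus
    vector (1, 0). Subtracting the conserved part leaves a solution of the delay
    system for the rank-one modification [deflated_matrix], in which the
    eigenvalue 0 has been moved to a harmless negative value. It remains to see
    that this solution tends to 0.

    Stability of y' = A y(t - tau). A second-order Taylor expansion at t of a
    solution of w' = lambda w(t - tau) + f gives
    w(t) = (1 + lambda tau) w(t - tau) + (error at most |lambda tau|^2 / 2 times
    the supremum of |w| on [t - 3 tau, t - tau], plus a multiple of the supremum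
    of |f|). If f tends to 0, so does w, as soon as
    |1 + lambda tau| + |lambda tau|^2 / 2 < 1 ([delay_stable], [delay_decay]). If every complex eigenvalue of A satisfies this, then so does
    every root of the characteristic polynomial, and Cayley-Hamilton lets one
    divide its linear factors out one at a time ([delay_system_decay]): neither
    a Jordan form nor the characteristic function of the delay equation is
    used. The condition [stability_margin T lambda] implies [delay_stable] for
    all delays up to T and is open in lambda.

    The uncoupled matrix (eps = 0). Its eigenvalues are those of the two negated
    Laplacians, so they lie in Gershgorin discs through 0, which gives
    |lambda|^2 <= 2 dbar |Re lambda|. Together with an explicit upper bound of
    atan on [0, 2], this yields [stability_margin] at [tau_tilde] for all the
    non-null ones ([gershgorin_margin], [uncoupled_margin]). The first-order
    condition |lambda|^2 T < |Re lambda|, T = [tau_tilde], can fail: for the complete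
    graph on two nodes lambda = -2, dbar = 1, and |lambda| T = atan 2 > 1. The
    second-order term in the Taylor expansion makes up for this.

    Small eps. Normalized left eigenpairs form a compact set, so it is enough to
    look near each eigenpair of the uncoupled matrix ([eigenpair_perturbation]).
    Near a non-null one, openness of the margin suffices. Near the eigenvalue 0,
    which is double for eps = 0, two linear identities decide
    ([near_uncoupled]): with w > 0 in the right kernel of the out-Laplacian, a
    left eigenvector (p, q) satisfies eps (p - q) w = lambda q w, and its first
    half sums to 0. In the limit q is constant and q - p is a multiple of the
    positive left kernel vector v of the in-Laplacian, so lambda / eps tends to
    a negative real number: lambda leaves 0 to the left, with |lambda|^2 of
    smaller order than |Re lambda|. *)

Local Notation Re := complex.Re.
Local Notation Im := complex.Im.
Local Notation complexify := (map_mx (real_complex _)).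
Local Notation eigentuple R m := (('rV[R]_m * 'rV[R]_m) * (R * R))%type.
Local Notation reV X := (X.1.1).
Local Notation imV X := (X.1.2).
Local Notation reL X := (X.2.1).
Local Notation imL X := (X.2.2).

(** * Scalar complex delay equations *)

Section ScalarDelay.
Context {R : realType}.
Implicit Types (w f : R -> R[i]) (lambda z : R[i]).

Definition normsq z : R := (Re z) ^+ 2 + (Im z) ^+ 2.

Lemma normsq_ge0 z : 0 <= normsq z.
Proof. by rewrite addr_ge0 ?sqr_ge0. Qed.

Lemma normc_sqrt z : normc z = Num.sqrt (normsq z).
Proof. by case: z. Qed.

Lemma normc_ge0 z : 0 <= normc z.
Proof. by rewrite normc_sqrt sqrtr_ge0. Qed.

Lemma normc_sqr z : normc z ^+ 2 = normsq z.
Proof. by rewrite normc_sqrt sqr_sqrtr // normsq_ge0. Qed.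

Lemma normc_le_ReIm z : normc z <= `|Re z| + `|Im z|.
Proof.
have sum_ge0 : 0 <= `|Re z| + `|Im z| by rewrite addr_ge0.
rewrite normc_sqrt -[leRHS]ger0_norm // -sqrtr_sqr ler_wsqrtr //.
rewrite sqrrD !real_normK ?num_real // /normsq addrAC lerDl.
by rewrite mulrn_wge0 // mulr_ge0.
Qed.

Lemma dotc_le z1 z2 : Re z1 * Re z2 + Im z1 * Im z2 <= normc z1 * normc z2.
Proof.
apply: le_trans (ler_norm _) _.
rewrite -sqrtr_sqr !normc_sqrt -sqrtrM ?normsq_ge0 // ler_wsqrtr // /normsq.
by have := sqr_ge0 (Re z1 * Im z2 - Im z1 * Re z2); nra.
Qed.

(** Componentwise, so that the real mean value theorem applies to every real
    projection of [w]. *)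
Definition is_derivec w (t : R) (dw : R[i]) : Prop :=
  is_derive t 1 (fun s => Re (w s)) (Re dw) /\
  is_derive t 1 (fun s => Im (w s)) (Im dw).

Lemma derive_le_growth (f df g dg : R -> R) (a b : R) : a <= b ->
  (forall t, a <= t <= b -> is_derive t 1 f (df t)) ->
  (forall t, a <= t <= b -> is_derive t 1 g (dg t)) ->
  (forall t, a <= t <= b -> df t <= dg t) ->
  f b - f a <= g b - g a.
Proof.
move=> ab hf hg le_d.
have hgf t : a <= t <= b -> is_derive t 1 (g - f) (dg t - df t).
  by move=> tab; have ? := hf t tab; have ? := hg t tab; exact: is_deriveB.
have [||c cab E] := @MVT_segment R (g - f) (fun t => dg t - df t) a b ab.
- by move=> t /[!in_itv]/= /andP[at_ tb]; apply: hgf; rewrite !ltW.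
- apply: derivable_within_continuous => t /[!in_itv]/= tab.
  by have [] := hgf t tab.
have : 0 <= (g - f) b - (g - f) a.
  by rewrite E mulr_ge0 ?subr_ge0 ?le_d //; move: cab; rewrite in_itv.
rewrite !fctE; lra.
Qed.

(** The vector-valued mean value inequality reduces to the real one by projecting
    [w] on the direction of its own increment [D]. *)
Lemma mean_value_ineq w (dw : R -> R[i]) (g dg : R -> R) (a b : R) : a <= b ->
  (forall t, a <= t <= b -> is_derivec w t (dw t)) ->
  (forall t, a <= t <= b -> is_derive t 1 g (dg t)) ->
  (forall t, a <= t <= b -> normc (dw t) <= dg t) ->
  normc (w b - w a) <= g b - g a.
Proof.
move=> ab hw hg le_dg; set D := w b - w a.
have proj : normc D ^+ 2 <= normc D * (g b - g a).
  have -> : normc D ^+ 2 = (Re D *: Re (w b) + Im D *: Im (w b)) -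
                           (Re D *: Re (w a) + Im D *: Im (w a)).
    by rewrite normc_sqr /normsq /D /GRing.scale /= !raddfB /=; ring.
  rewrite mulrBr.
  apply: (@derive_le_growth (fun t => Re D *: Re (w t) + Im D *: Im (w t))
    (fun t => Re D *: Re (dw t) + Im D *: Im (dw t))
    (fun t => normc D *: g t) (fun t => normc D *: dg t) a b ab) => t tab.
  - by have [? ?] := hw t tab; exact: is_deriveD.
  - by have ? := hg t tab; exact: is_deriveZ.
  - by apply: le_trans (dotc_le _ _) _; rewrite ler_wpM2l ?normc_ge0 // le_dg.
have := normc_ge0 D; rewrite le_eqVlt => /orP[/eqP<-|D_gt0]; last first.
  by move: proj; rewrite expr2 ler_pM2l.
rewrite -(subrr (0 : R)).
apply: (@derive_le_growth (fun=> 0) (fun=> 0) g dg a b ab) => // t tab.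
exact: le_trans (normc_ge0 _) (le_dg t tab).
Qed.

Variables (lambda : R[i]) (tau T0 : R) (w f : R -> R[i]).
Hypothesis tau_gt0 : 0 < tau.
Hypothesis w_delay : forall t, T0 < t ->
  is_derivec w t (lambda * w (t - tau) + f t).

Let l : R := normc lambda.

Lemma delay_lipschitz (W F s t : R) : s <= t -> T0 < s ->
  (forall r : R, s - tau <= r <= t - tau -> normc (w r) <= W) ->
  (forall r : R, s <= r <= t -> normc (f r) <= F) ->
  normc (w t - w s) <= (l * W + F) * (t - s).
Proof.
move=> st T0s wW fF.
rewrite mulrBr; pose g (r : R) : R := (l * W + F) *: r.
rewrite -[leRHS]/(g t - g s).
apply: (@mean_value_ineq w (fun r => lambda * w (r - tau) + f r) g
          (fun=> l * W + F)) => // r /andP[sr rt].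
- by apply: w_delay; apply: lt_le_trans sr.
- by rewrite -[X in is_derive _ _ _ X]mulr1; exact: is_deriveZ.
- apply: le_trans (le_normcD _ _) _; rewrite normcM lerD //.
    by rewrite ler_wpM2l ?normc_ge0 // wW // !lerD2r sr.
  by rewrite fF // sr.
Qed.

(** Second-order Taylor expansion at [t]: [w t - w (t - tau)] is the integral of
    [lambda w (s - tau) + f s], and [w (s - tau)] differs from [w (t - tau)] by at
    most [(l W + F) (t - s)]. *)
Lemma delay_step (W F t : R) : T0 < t - 2 * tau ->
  (forall s : R, t - 3 * tau <= s <= t - tau -> normc (w s) <= W) ->
  (forall s : R, t - 2 * tau <= s <= t -> normc (f s) <= F) ->
  normc (w t) <= (normc (1 + lambda * tau%:C) + l ^+ 2 * tau ^+ 2 / 2) * W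
                 + (l * tau ^+ 2 / 2 + tau) * F.
Proof.
move=> T0t wW fF; have tau0 := tau_gt0.
pose v := w (t - tau); pose K := l * W + F.
have hv (s : R) : t - tau <= s <= t -> normc (w (s - tau) - v) <= K * (t - s).
  move=> /andP[ts st]; rewrite -normcN opprB /v.
  have -> : t - s = (t - tau) - (s - tau) by ring.
  apply: delay_lipschitz; try lra.
  - by move=> r /andP[r1 r2]; apply: wW; apply/andP; split; lra.
  - by move=> r /andP[r1 r2]; apply: fF; apply/andP; split; lra.
(* The increment of k over [t - tau, t] is exactly the Taylor remainder. *)
pose k (s : R) := w s - s%:C * (lambda * v).
pose dk (s : R) := lambda * (w (s - tau) - v) + f s.
pose g (s : R) : R := F *: s + (- (l * K / 2)) *: (t - s) ^+ 2.
have : normc (k t - k (t - tau)) <= g t - g (t - tau).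
  apply: (@mean_value_ineq k dk g (fun s => l * K * (t - s) + F)); first lra.
  - move=> s /andP[s1 s2]; have [|wr wi] := @w_delay s; first lra.
    pose c := lambda * v.
    split.
    + have -> : (fun r => Re (k r)) = (fun r => Re (w r) - Re c *: r).
        apply/funext => r; rewrite /k raddfB /= -/c; case: c => ? ? /=.
        by rewrite /GRing.scale /=; ring.
      have -> : Re (dk s) = Re (lambda * w (s - tau) + f s) - Re c *: 1.
        by rewrite /dk mulrBr addrAC raddfB /= /GRing.scale /= mulr1.
      exact: is_deriveB.
    + have -> : (fun r => Im (k r)) = (fun r => Im (w r) - Im c *: r).
        apply/funext => r; rewrite /k raddfB /= -/c; case: c => ? ? /=.
        by rewrite /GRing.scale /=; ring.
      have -> : Im (dk s) = Im (lambda * w (s - tau) + f s) - Im c *: 1.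
        by rewrite /dk mulrBr addrAC raddfB /= /GRing.scale /= mulr1.
      exact: is_deriveB.
  - move=> s _; rewrite /g; apply: is_derive_eq.
    by rewrite /GRing.scale /=; field.
  - move=> s sI; rewrite /dk; apply: le_trans (le_normcD _ _) _.
    apply: lerD; first by rewrite normcM -mulrA ler_wpM2l ?normc_ge0 // hv.
    by apply: fF; case/andP: sI => ? ?; apply/andP; split; lra.
have -> : k t - k (t - tau) = w t - (1 + lambda * tau%:C) * v.
  by rewrite /k -/v rmorphB /=; ring.
have -> : g t - g (t - tau) = l * K * tau ^+ 2 / 2 + F * tau.
  by rewrite /g /GRing.scale /=; field.
move=> wt.
have -> : w t = (w t - (1 + lambda * tau%:C) * v) + (1 + lambda * tau%:C) * v.
  by rewrite subrK.
apply: le_trans (le_normcD _ _) _; apply: le_trans (lerD wt (lexx _)) _.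
have vW : normc v <= W by apply: wW; apply/andP; split; lra.
rewrite normcM /K; have := ler_wpM2l (normc_ge0 (1 + lambda * tau%:C)) vW.
by lra.
Qed.

(** The bound at [t] involves the past only up to [t - tau], so it propagates in
    steps of length [tau]; after each further time [3 tau] the whole window has
    been contracted once more, up to the fixed point [c / (1 - rho)]. *)
Lemma contraction_decay (N : R -> R) (a rho c W : R) :
  0 <= rho < 1 -> 0 <= c -> 0 <= W ->
  (forall t V, a + 3 * tau <= t ->
     (forall s : R, t - 3 * tau <= s <= t - tau -> N s <= V) ->
     N t <= rho * V + c) ->
  (forall s : R, a <= s <= a + 3 * tau -> N s <= W) ->
  forall k t, a + 3 * tau * k%:R <= t -> N t <= rho ^+ k * W + c / (1 - rho).
Proof.
move=> /andP[rho0 rho1] c0 W0 contr NW; have tau0 := tau_gt0.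
set d := c / (1 - rho).
have dE : rho * d + c = d by rewrite /d; field; rewrite subr_eq0 eq_sym lt_eqF.
have d0 : 0 <= d by rewrite divr_ge0 // subr_ge0 ltW.
have NWd j t : a <= t <= a + (3 + j%:R) * tau -> N t <= W + d.
  elim: j t => [|j IH] t /andP[at_ tj].
    by apply: ler_wpDr => //; apply: NW; rewrite at_ /= (le_trans tj) // addr0.
  have [t3|t3] := leP t (a + 3 * tau).
    by apply: ler_wpDr => //; apply: NW; rewrite at_.
  apply: le_trans (contr t (W + d) (ltW t3) _) _.
    move=> s /andP[s1 s2]; apply: IH; apply/andP; split; first lra.
    by move: tj; rewrite -(natr1 j); lra.
  by rewrite mulrDr -addrA dE lerD2r ler_piMl // ltW.
elim=> [|k IH] t kt.
  have at_ : a <= t by move: kt; rewrite mulr0 addr0.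
  rewrite expr0 mul1r; apply: (NWd (Num.trunc ((t - a) / tau)).+1).
  rewrite at_ /= -lerBlDl -ler_pdivrMr //.
  apply: ltW; apply: lt_le_trans (truncnS_gt _) _.
  by rewrite lerDr.
apply: le_trans (contr t (rho ^+ k * W + d) _ _) _.
- apply: le_trans kt; rewrite -(natr1 k) mulrDr mulr1 lerD2l ler_wpDl //.
  by rewrite !mulr_ge0 // ltW.
- move=> s /andP[s1 _]; apply: IH; move: kt; rewrite -(natr1 k); lra.
- by rewrite exprS mulrDr mulrA -addrA dE.
Qed.

Lemma normc_bounded_on (a b : R) : T0 < a -> a <= b ->
  exists2 W, 0 <= W & forall s : R, a <= s <= b -> normc (w s) <= W.
Proof.
move=> T0a ab.
have cvgN (h : R -> R) : (forall t, T0 < t -> derivable h t 1) ->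
    exists M : R, forall t, a <= t <= b -> `|h t| <= M.
  move=> dh; have ch : {within `[a, b], continuous (fun t => `|h t|)}.
    have ch : {within `[a, b], continuous h}.
      apply: derivable_within_continuous => t /[!in_itv]/= /andP[at_ _].
      exact/dh/(lt_le_trans T0a).
    by move=> t; apply: cvg_norm; apply: ch.
  have [c _ hc] := EVT_max ab ch.
  by exists `|h c| => t tab; apply: hc; rewrite in_itv.
have [|M1 hM1] := @cvgN (fun t => Re (w t)).
  by move=> t /w_delay[[]].
have [|M2 hM2] := @cvgN (fun t => Im (w t)).
  by move=> t /w_delay[_ []].
have bound s : a <= s <= b -> normc (w s) <= M1 + M2.
  by move=> sab; apply: le_trans (normc_le_ReIm _) _; rewrite lerD ?hM1 ?hM2.
exists (M1 + M2) => //.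
by apply: le_trans (bound a _); rewrite ?normc_ge0 // lexx.
Qed.

Lemma delay_decay :
  normc (1 + lambda * tau%:C) + l ^+ 2 * tau ^+ 2 / 2 < 1 ->
  normc (f t) @[t --> +oo] --> (0 : R) ->
  normc (w t) @[t --> +oo] --> (0 : R).
Proof.
set rho := _ + _ => rho1 f0; have tau0 := tau_gt0.
have rho0 : 0 <= rho.
  by rewrite addr_ge0 ?normc_ge0 // divr_ge0 // mulr_ge0 ?sqr_ge0.
set C := l * tau ^+ 2 / 2 + tau.
have C0 : 0 < C.
  by rewrite ltr_wpDl // divr_ge0 // mulr_ge0 ?normc_ge0 ?sqr_ge0.
apply/cvgr0Pnorm_le => e e0.
(* With |f| at most F, the fixed point C F / (1 - rho) is e / 2. *)
pose F := e / 2 * (1 - rho) / C.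
have F0 : 0 < F by rewrite !(mulr_gt0, invr_gt0) // subr_gt0.
have [T1 [_ hT1]] : \forall t \near +oo, normc (f t) <= F.
  move: f0 => /cvgr0Pnorm_le /(_ F F0) f0; near=> t.
  have : `|normc (f t)| <= F by near: t.
  by rewrite ger0_norm // normc_ge0.
pose a := Num.max T0 T1 + 1.
have T0a : T0 < a by rewrite ltr_pwDr // le_max lexx.
have T1a : T1 < a by rewrite ltr_pwDr // le_max lexx orbT.
have [W W0 hW] := @normc_bounded_on a (a + 3 * tau) T0a ltac:(lra).
have decay := @contraction_decay (fun t => normc (w t)) a rho (C * F) W
  _ _ W0 _ hW.
have {}decay k t : a + 3 * tau * k%:R <= t -> normc (w t) <= rho ^+ k * W + e / 2.
  have -> : e / 2 = C * F / (1 - rho).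
    by rewrite /F; field; rewrite subr_eq0 !gt_eqF.
  apply: decay.
  - by rewrite rho0.
  - by rewrite mulr_ge0 // ltW.
  - move=> r V ar hV; apply: delay_step => //; first lra.
    by move=> s /andP[s1 s2]; apply: hT1; lra.
have [k rhoW] : exists k, rho ^+ k * W <= e / 2.
  have : rho ^+ k * W @[k --> \oo] --> 0 * W.
    by apply: cvgM; [apply: (@cvg_expr R); rewrite ger0_norm|exact: cvg_cst].
  rewrite mul0r => /cvgr0Pnorm_le /(_ (e / 2)) -/(_ ltac:(lra)) [k _ hk].
  by exists k; apply: le_trans (ler_norm _) (hk k _) => /=.
near=> t; rewrite ger0_norm ?normc_ge0 // [leRHS]splitr.
apply: le_trans (decay k t _) _; last by rewrite lerD2r.
by near: t; apply: nbhs_pinfty_ge; exact: num_real.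
Unshelve. all: by end_near. Qed.

End ScalarDelay.

(** * Linear delay systems *)

Section MatrixDelay.
Context {R : realType} {m : nat}.

(** Sufficient for the stability of [w' = lambda w(t - tau)]: the contraction
    constant of the second-order Taylor expansion is less than 1. *)
Definition delay_stable (tau : R) (lambda : R[i]) : Prop :=
  normc (1 + lambda * tau%:C) + normc lambda ^+ 2 * tau ^+ 2 / 2 < 1.

Lemma is_derive_coord p q (y : R -> 'M[R]_(p, q)) (t : R) (dy : 'M[R]_(p, q)) i j :
  is_derive t 1 y dy -> is_derive t 1 (fun s => y s i j) (dy i j).
Proof.
move=> [y_der <-]; split; first by have /derivable_mxP := y_der; apply.
by rewrite derive_mx // mxE.
Qed.

Lemma Re_mul_real (z : R[i]) (x : R) : Re (z * x%:C) = Re z * x.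
Proof. by case: z => a b /=; ring. Qed.

Lemma Im_mul_real (z : R[i]) (x : R) : Im (z * x%:C) = Im z * x.
Proof. by case: z => a b /=; ring. Qed.

Lemma is_derivec_mulmx p (P : 'M[R[i]]_(p, m)) (y : R -> 'cV[R]_m) (t : R)
    (dy : 'cV[R]_m) i :
  is_derive t 1 y dy ->
  is_derivec (fun s => (P *m complexify (y s)) i 0) t ((P *m complexify dy) i 0).
Proof.
move=> hy.
have comb (c : 'I_m -> R) : is_derive t 1 (fun s => \sum_j c j * y s j 0)
    (\sum_j c j * dy j 0).
  have -> : (fun s => \sum_j c j * y s j 0) = \sum_j (c j *: (fun s => y s j 0)).
    by apply/funext => s; rewrite fct_sumE.
  by apply: is_derive_sum => j; apply: is_deriveZ; exact: is_derive_coord.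
have ReE (v : 'cV[R]_m) :
    Re ((P *m complexify v) i 0) = \sum_j Re (P i j) * v j 0.
  by rewrite mxE raddf_sum; apply: eq_bigr => j _; rewrite mxE -Re_mul_real.
have ImE (v : 'cV[R]_m) :
    Im ((P *m complexify v) i 0) = \sum_j Im (P i j) * v j 0.
  by rewrite mxE raddf_sum; apply: eq_bigr => j _; rewrite mxE -Im_mul_real.
split; [rewrite ReE|rewrite ImE].
  by under eq_fun do rewrite ReE; exact: comb.
by under eq_fun do rewrite ImE; exact: comb.
Qed.

End MatrixDelay.

Section MatrixDelayDecay.
Context {R : realType} {m : nat}.
Variables (A : 'M[R]_m.+1) (tau T0 : R) (y : R -> 'cV[R]_m.+1).
Hypothesis tau_gt0 : 0 < tau.
Hypothesis y_delay : forall t, T0 < t -> is_derive t 1 y (A *m y (t - tau)).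
Let AC : 'M[R[i]]_m.+1 := complexify A.
Let decays (P : 'M[R[i]]_m.+1) :=
  forall i, normc ((P *m complexify (y t)) i 0) @[t --> +oo] --> (0 : R).

(** Each entry of [P y] solves the scalar delay equation for [z] with a forcing
    term made of the entries of [P (A - z) y]. *)
Lemma decays_divide_factor P z : delay_stable tau z ->
  decays (P *m (AC - z%:M)) -> decays P.
Proof.
move=> z_stable decP i.
apply: (@delay_decay _ z tau T0 (fun t => (P *m complexify (y t)) i 0)
  (fun t => (P *m (AC - z%:M) *m complexify (y (t - tau))) i 0)) => //.
- move=> t T0t; have := is_derivec_mulmx P i (y_delay T0t).
  have -> : P *m complexify (A *m y (t - tau)) =
      z *: (P *m complexify (y (t - tau))) +
      P *m (AC - z%:M) *m complexify (y (t - tau)).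
    rewrite map_mxM mulmxA mulmxBr mulmxBl mul_mx_scalar -scalemxAl.
    by rewrite [RHS]addrC subrK.
  by rewrite mxE [X in is_derivec _ _ (X + _)]mxE.
- have := decP i; set g := (fun t => normc ((_ *m complexify (y t)) i 0)) => g0.
  have : (fun t => g (t - tau)) @ +oo --> (0 : R).
    apply: (cvg_comp _ _ _ g0) => //.
    exact: cvg_addrr.
  by [].
Qed.

Lemma decays_divide_product (rs : seq R[i]) P :
  (forall z, z \in rs -> delay_stable tau z) ->
  decays (P *m \prod_(z <- rs) (AC - z%:M)) -> decays P.
Proof.
elim: rs P => [|z rs IH] P rs_stable.
  by rewrite big_nil mulmx1.
rewrite big_cons -mulmxE mulmxA => /IH decPz.
apply: (@decays_divide_factor P z); first by apply: rs_stable; rewrite mem_head.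
by apply: decPz => x xrs; apply: rs_stable; rewrite in_cons xrs orbT.
Qed.

Lemma delay_system_decay_succ :
  (forall z, eigenvalue AC z -> delay_stable tau z) ->
  forall i, y t i 0 @[t --> +oo] --> (0 : R).
Proof.
move=> A_stable i.
have [rs] := closed_field_poly_normal (char_poly AC).
rewrite (monicP (char_poly_monic _)) scale1r => char_prod.
have prod0 : \prod_(z <- rs) (AC - z%:M) = 0.
  have := Cayley_Hamilton AC; rewrite char_prod rmorph_prod /= => <-.
  by apply: eq_bigr => z _; rewrite rmorphB /= horner_mx_X horner_mx_C.
have : decays 1%:M.
  apply: (@decays_divide_product rs) => [z zrs|].
    apply: A_stable; rewrite eigenvalue_root_char char_prod.
    by rewrite root_prod_XsubC.
  move=> j; rewrite prod0 mulmx0; under eq_fun do rewrite mul0mx mxE normc0.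
  exact: cvg_cst.
move=> /(_ i) y0; apply/norm_cvg0P; apply: cvg_trans y0; apply: near_eq_cvg.
near=> t; rewrite mul1mx mxE /= expr0n /= addr0 sqrtr_sqr //.
Unshelve. all: by end_near. Qed.

End MatrixDelayDecay.

Theorem delay_system_decay (R : realType) (m : nat) (A : 'M[R]_m) (tau T0 : R)
    (y : R -> 'cV[R]_m) :
  0 < tau ->
  (forall t, T0 < t -> is_derive t 1 y (A *m y (t - tau))) ->
  (forall z, eigenvalue (map_mx (real_complex R) A) z -> delay_stable tau z) ->
  forall i, y t i 0 @[t --> +oo] --> (0 : R).
Proof.
case: m A y => [|m] A y tau0 hy stable; first by case.
exact: (delay_system_decay_succ tau0 hy stable).
Qed.

(** * A stability condition uniform in the delay *)

Section StabilityMargin.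
Context {R : realType}.

(** For [T = tau], the second inequality is [|1 + z tau| < 1 - |z tau|^2 / 2] after
    squaring and division by [2 tau]; the first one makes the right side
    positive. *)
Definition stability_margin (T : R) (z : R[i]) : Prop :=
  normsq z * T ^+ 2 < 2 /\
  normsq z * T * (1 - normsq z * T ^+ 2 / 8) < - Re z.

(** [tau (1 - L tau^2 / 8)] increases with [tau] as long as [L tau^2 < 8 / 3], so
    the margin is inherited by smaller delays. *)
Lemma stability_margin_delay_stable (T tau : R) (z : R[i]) : 0 < tau -> tau <= T ->
  stability_margin T z -> delay_stable tau z.
Proof.
move=> tau0 tauT [LT2 LTz]; rewrite /delay_stable normc_sqr.
set L := normsq z in LT2 LTz *; have L0 : 0 <= L := normsq_ge0 z.
have T0 : 0 < T by apply: lt_le_trans tauT.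
have Ltau2 : L * tau ^+ 2 < 2.
  by apply: le_lt_trans LT2; rewrite ler_wpM2l // ler_sqr ?nnegrE // ltW.
have Ltau : L * tau * (1 - L * tau ^+ 2 / 8) < - Re z.
  apply: le_lt_trans LTz; rewrite -subr_ge0.
  have -> : L * T * (1 - L * T ^+ 2 / 8) - L * tau * (1 - L * tau ^+ 2 / 8) =
     L * (T - tau) * (1 - (L * T ^+ 2 + L * (T * tau) + L * tau ^+ 2) / 8).
    by field.
  have : L * (T * tau) <= L * T ^+ 2 by rewrite ler_wpM2l // expr2 ler_pM2l.
  by move=> ?; rewrite mulr_ge0 ?mulr_ge0 ?subr_ge0 //; lra.
have -> : normc (1 + z * tau%:C) = Num.sqrt (1 + 2 * tau * Re z + L * tau ^+ 2).
  by rewrite normc_sqrt /L /normsq; case: (z) => a b /=; congr Num.sqrt; ring.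
rewrite -ltrBrDr -[ltRHS]ger0_norm; last by lra.
rewrite -sqrtr_sqr ltr_sqrt; last by rewrite exprn_even_gt0 //=; apply/eqP; lra.
by nra.
Qed.

Lemma atan_le_id (x : R) : 0 <= x -> atan x <= x.
Proof.
move=> x0; suff : atan x - atan 0 <= x - 0 by rewrite atan0 !subr0.
apply: (@derive_le_growth R (@atan R) (fun t => (1 + t ^+ 2)^-1) id (fun=> 1)
  0 x x0) => t _.
by rewrite invf_le1 ?lerDl ?sqr_ge0 // ltr_wpDr ?sqr_ge0.
Qed.

Lemma atan1_le : atan 1 <= 13 / 15 :> R.
Proof.
pose g (x : R) : R := x - 3^-1 *: x ^+ 3 + 5^-1 *: x ^+ 5.
have -> : 13 / 15 = g 1 - g 0 :> R by rewrite /g /GRing.scale /=; field.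
suff : atan 1 - atan 0 <= g 1 - g 0 :> R by rewrite atan0 subr0.
apply: (@derive_le_growth R (@atan R) (fun t => (1 + t ^+ 2)^-1) g
  (fun t => 1 - t ^+ 2 + t ^+ 4) 0 1 ler01) => t _.
  by apply: is_derive_eq; rewrite /GRing.scale /=; field.
have d0 : 0 < 1 + t ^+ 2 by rewrite ltr_wpDr ?sqr_ge0.
rewrite -[leLHS]mul1r ler_pdivrMr //.
have -> : (1 - t ^+ 2 + t ^+ 4) * (1 + t ^+ 2) = 1 + (t ^+ 3) ^+ 2 by ring.
by rewrite lerDl sqr_ge0.
Qed.

(** The third-order Taylor polynomial of [atan] at 1, with [13 / 15] in place of
    [pi / 4]; its derivative times [1 + t^2] is [1 + (t - 1)^4 / 4]. *)
Lemma atan_le_cubic (x : R) : 1 <= x ->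
  atan x <= 13 / 15 + (x - 1) / 2 - (x - 1) ^+ 2 / 4 + (x - 1) ^+ 3 / 12.
Proof.
move=> x1; pose g (t : R) : R :=
  2^-1 *: (t - 1) - 4^-1 *: (t - 1) ^+ 2 + 12^-1 *: (t - 1) ^+ 3.
suff : atan x - atan 1 <= g x - g 1.
  by have := atan1_le; rewrite /g /GRing.scale /= subrr !expr0n /=; lra.
apply: (@derive_le_growth R (@atan R) (fun t => (1 + t ^+ 2)^-1) g
  (fun t => 1 / 2 - (t - 1) / 2 + (t - 1) ^+ 2 / 4) 1 x x1) => t _.
  by apply: is_derive_eq; rewrite /GRing.scale /=; field.
have d0 : 0 < 1 + t ^+ 2 by rewrite ltr_wpDr ?sqr_ge0.
rewrite -[leLHS]mul1r ler_pdivrMr //.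
have -> : (1 / 2 - (t - 1) / 2 + (t - 1) ^+ 2 / 4) * (1 + t ^+ 2) =
  1 + ((t - 1) ^+ 2 / 2) ^+ 2 by field.
by rewrite lerDl sqr_ge0.
Qed.

(** The arithmetic heart of the delay bound. For [x <= 1] it suffices that
    [theta <= x]. For [1 < x <= 2], [theta] may exceed 1 (up to [atan 2], about
    1.107), and the cubic term is needed to get below 1. *)
Lemma atan_margin (x theta : R) : 0 < x -> x <= 2 -> 0 <= theta ->
  theta <= atan x ->
  theta <= 6 / 5 /\ theta * (1 - x * theta ^+ 2 / 16) < 1.
Proof.
move=> x0 x2 th0 thx.
have [x1|x1] := leP x 1.
  have th1 : theta <= x by apply: le_trans thx (atan_le_id (ltW x0)).
  split; first lra.
  have [->|thp] : theta = 0 \/ 0 < theta.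
    by move: th0; rewrite le_eqVlt => /orP[/eqP<-|]; [left|right].
    by rewrite mul0r.
  have : 0 < x * theta ^+ 2 * theta by rewrite !mulr_gt0.
  by rewrite mulrBr; nra.
have thQ := le_trans thx (atan_le_cubic (ltW x1)).
have [u [u0 u1 xE]] : exists u, [/\ 0 <= u, u <= 1 & x = 1 + u].
  by exists (x - 1); split; lra.
have {}thQ : theta <= 13 / 15 + u / 2 - u ^+ 2 / 6.
  apply: (le_trans thQ); rewrite xE (addrC 1 u) addrK.
  have : 0 <= u ^+ 2 * (1 - u) by rewrite mulr_ge0 ?sqr_ge0 ?subr_ge0.
  by nra.
have th65 : theta <= 6 / 5 by nra.
split=> //.
(* Tangent line of the cube at 11/10. *)
have tangent : (363 / 100) * theta - 2662 / 1000 <= theta ^+ 3.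
  have : 0 <= (theta - 11 / 10) ^+ 2 * (theta + 22 / 10).
    by rewrite mulr_ge0 ?sqr_ge0 //; lra.
  by nra.
have -> : theta * (1 - x * theta ^+ 2 / 16) = theta - x * theta ^+ 3 / 16.
  by field.
have step : theta - x * theta ^+ 3 / 16 <=
    theta - x * ((363 / 100) * theta - 2662 / 1000) / 16.
  have := ler_wpM2l (ltW x0) tangent; lra.
apply: (le_lt_trans step); rewrite xE.
have : theta * (1 - (1 + u) * (363 / 1600)) <=
    (13 / 15 + u / 2 - u ^+ 2 / 6) * (1 - (1 + u) * (363 / 1600)).
  have k0 : 0 <= 1 - (1 + u) * (363 / 1600) by lra.
  exact: ler_wpM2r k0 _ _ thQ.
have : 0 <= u ^+ 2 * (1 - u) by rewrite mulr_ge0 ?sqr_ge0 ?subr_ge0.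
(* What is left is a concave quadratic in u whose maximum is near 87/100. *)
have := sqr_ge0 (u - 87 / 100).
lra.
Qed.

(** In units of [delta], the disc condition reads [|z|^2 <= 2 x] with
    [x = - Re z <= 2], and the left side of the margin increases with [|z|^2]:
    the boundary case [|z|^2 = 2 x] is the inequality of [atan_margin]. *)
Lemma gershgorin_margin (delta a3 : R) (z : R[i]) :
  0 < delta -> z != 0 -> normsq z <= - (2 * delta * Re z) ->
  0 <= a3 -> a3 <= - Re z ->
  stability_margin (1 / (2 * delta) * atan (a3 / delta)) z.
Proof.
move=> d0 z0; set L := normsq z => Ldz a30 a3z.
have L0 : 0 < L.
  rewrite lt_neqAle normsq_ge0 andbT eq_sym; apply: contra z0.
  by rewrite /L -normc_sqr expf_eq0 /= => /eqP /eq0_normc ->.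
have aL : Re z ^+ 2 <= L by rewrite lerDl sqr_ge0.
pose x := - Re z / delta.
have zE : Re z = - (delta * x) by rewrite /x mulrC divfK ?opprK // gt_eqF.
rewrite zE in Ldz aL a3z *.
have x0 : 0 < x.
  have : 0 < 2 * delta ^+ 2 * x by lra.
  by rewrite pmulr_rgt0 // mulr_gt0 // exprn_gt0.
have x2 : x <= 2 by nra.
set theta := atan (a3 / delta).
have th0 : 0 <= theta by rewrite -(atan0 R) le_atan // divr_ge0 // ltW.
have thx : theta <= atan x.
  by apply: le_atan; rewrite ler_pdivrMr // mulrC; lra.
have [th65 margin] := atan_margin x0 x2 th0 thx.
set T := 1 / (2 * delta) * theta.
have thE : theta = 2 * delta * T.
  by rewrite /T; field; rewrite gt_eqF.
have T0 : 0 <= T by rewrite mulr_ge0 // divr_ge0 // mulr_ge0 // ltW.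
have LT2 : L * T ^+ 2 <= x * theta ^+ 2 / 2.
  have -> : x * theta ^+ 2 / 2 = 2 * delta ^+ 2 * x * T ^+ 2.
    by rewrite thE; field.
  by rewrite ler_wpM2r ?sqr_ge0 //; nra.
have xth : x * theta ^+ 2 <= 3.
  have : theta ^+ 2 <= 3 / 2 by nra.
  by have := sqr_ge0 theta; nra.
split; first by apply: (le_lt_trans LT2); lra.
pose L' := 2 * delta ^+ 2 * x.
have LL' : L <= L' by rewrite /L'; nra.
have L'T2 : L' * T ^+ 2 = x * theta ^+ 2 / 2 by rewrite /L' thE; field.
rewrite zE opprK.
apply: (@le_lt_trans _ _ (L' * T * (1 - L' * T ^+ 2 / 8))).
  rewrite -subr_ge0.
  have -> : L' * T * (1 - L' * T ^+ 2 / 8) - L * T * (1 - L * T ^+ 2 / 8) =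
    T * (L' - L) * (1 - (L' * T ^+ 2 + L * T ^+ 2) / 8) by field.
  have sum_le8 : 0 <= 1 - (L' * T ^+ 2 + L * T ^+ 2) / 8.
    by rewrite L'T2; move: (L * T ^+ 2) LT2 => q qle; lra.
  apply: mulr_ge0 sum_le8; apply: mulr_ge0 => //; by rewrite subr_ge0.
have -> : L' * T * (1 - L' * T ^+ 2 / 8) =
    delta * x * (theta * (1 - x * theta ^+ 2 / 16)).
  by rewrite L'T2 /L' thE; field.
by rewrite -[ltRHS]mulr1 ltr_pM2l // mulr_gt0.
Qed.

End StabilityMargin.

(** * Laplacians of strongly connected graphs *)

Section Balanced.
Context {R : realType} {n : nat}.
Implicit Types (E : rel 'I_n) (d v w : 'I_n -> R).

(** [v] is a left null vector of the Laplacian with degrees [d]. For the in-degrees,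
    [v d] is a stationary measure of the random walk along the edges; for the
    out-degrees, [v] is a harmonic function. *)
Definition balanced E d v : Prop :=
  forall j, v j * d j = \sum_i v i * (E i j)%:R.

(** Zeros propagate backwards along the edges. *)
Lemma balanced_zero E d v (k : 'I_n) : strongly_connected E -> balanced E d v ->
  (forall i, 0 <= v i) -> v k = 0 -> forall i, v i = 0.
Proof.
move=> scE bal v0 vk i; have /connectP[p pE lastp] := scE i k.
elim: p i pE lastp => [|j p IH] i /=; first by move=> _ <-.
move=> /andP[Eij pE] lastp; have vj := IH j pE lastp.
have := bal j; rewrite vj mul0r => /esym sum0.
have terms0 l : true -> 0 <= v l * (E l j)%:R by rewrite mulr_ge0.
by have := psumr_eq0P terms0 sum0 => /(_ i isT); rewrite Eij mulr1.
Qed.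

(** Subtracting from [u] the largest multiple of [v] below it leaves a nonnegative
    balanced vector with a zero. *)
Lemma balanced_proportional E d v u : strongly_connected E -> balanced E d v ->
  (forall i, 0 < v i) -> balanced E d u -> exists c, forall i, u i = c * v i.
Proof.
move=> scE balv v0 balu.
have [/eqP n0|] := boolP (n == 0%N).
  by exists 0; move=> i; have := ltn_ord i; rewrite [X in (_ < X)%N]n0.
rewrite -lt0n => n0; pose i0 := Ordinal n0.
pose k := [arg min_(i < i0) (u i / v i)]%O.
have kmin i : u k / v k <= u i / v i.
  by rewrite /k; case: (@Order.TotalTheory.arg_minP) => // j _; apply.
exists (u k / v k); move=> i; apply/eqP; rewrite -subr_eq0; apply/eqP.
apply: (@balanced_zero E d (fun i => u i - u k / v k * v i) k) => //.
- move=> j; rewrite mulrBl balu -[_ * v j * d j]mulrA balv mulr_sumr -sumrB.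
  by apply: eq_bigr => l _; ring.
- by move=> j; rewrite subr_ge0 -ler_pdivlMr.
- by rewrite divfK ?subrr // gt_eqF.
Qed.

Definition laplacian E d : 'M[R]_n := diag_mx (\row_i d i) - adjacency R E.

Lemma mul_laplacian E d (u : 'rV[R]_n) j :
  (u *m laplacian E d) 0 j = u 0 j * d j - \sum_i u 0 i * (E i j)%:R.
Proof.
rewrite mulmxBr mul_mx_diag !mxE; congr (_ - _).
by apply: eq_bigr => i _; rewrite mxE.
Qed.

Lemma mul_laplacian_eq0 E d (u : 'rV[R]_n) :
  u *m laplacian E d = 0 -> balanced E d (u 0).
Proof.
move=> /matrixP /(_ 0) uL j; apply/eqP; rewrite -subr_eq0 -mul_laplacian uL.
by rewrite mxE.
Qed.

Lemma laplacian_col_null E d : (forall i, \sum_j (E i j)%:R = d i) ->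
  laplacian E d *m const_mx 1 = 0 :> 'cV[R]_n.
Proof.
move=> rowE; apply/matrixP => i j; rewrite mulmxBl mul_diag_mx !mxE mulr1.
rewrite -rowE -sumrB big1 // => k _; rewrite !mxE mulr1; exact: subrr.
Qed.

(** Perron vector: the absolute value of a real left null vector [u] satisfies the
    balance equations as inequalities, and summing these over all nodes gives an
    equality. *)
Lemma balanced_positive_exists E d : (0 < n)%N -> strongly_connected E ->
  (forall i, \sum_j (E i j)%:R = d i) ->
  exists2 v, (forall i, 0 < v i) & balanced E d v.
Proof.
move=> n0 scE rowE.
have d0 i : 0 <= d i by rewrite -rowE sumr_ge0.
have det0 : \det (laplacian E d) == 0.
  apply/negPn/negP; rewrite -unitfE => Lunit.
  have := laplacian_col_null rowE => /(congr1 (mulmx (invmx (laplacian E d)))).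
  rewrite mulKmx // mulmx0 => /matrixP /(_ (Ordinal n0) 0) /eqP.
  by rewrite !mxE oner_eq0.
have [u u0 uL] := det0P det0; have balu := mul_laplacian_eq0 uL.
pose v i := `|u 0 i|.
have le_v j : v j * d j <= \sum_i v i * (E i j)%:R.
  rewrite /v -[X in _ * X]ger0_norm // -normrM balu.
  apply: le_trans (ler_norm_sum _ _ _) _; apply: ler_sum => i _.
  by rewrite normrM [X in _ * X]ger0_norm.
have balv : balanced E d v.
  move=> j; apply/eqP; rewrite eq_sym -subr_eq0; apply/eqP.
  apply: (@psumr_eq0P _ _ predT
    (fun j => \sum_i v i * (E i j)%:R - v j * d j)) => //.
    by move=> l _; rewrite subr_ge0.
  rewrite sumrB exchange_big /= -sumrB big1 // => i _.
  by rewrite -mulr_sumr rowE subrr.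
exists v => //; move=> i; rewrite lt_neqAle normr_ge0 andbT eq_sym.
apply: contra u0 => /eqP vi0; apply/eqP/matrixP => a j; rewrite ord1 mxE.
apply/eqP; rewrite -normr_eq0; apply/eqP.
by apply: (@balanced_zero E d v i) => // k; exact: normr_ge0.
Qed.

(** Gershgorin's theorem for a left eigenvector, in the l1 norm weighted by a
    positive right null vector [w] of the Laplacian; the weights make the same
    argument work for both Laplacians. *)
Lemma gershgorin_weighted E d w (z : R[i]) (u : 'I_n -> R[i]) :
  (forall i, 0 < w i) -> (forall i, \sum_j (E i j)%:R * w j = d i * w i) ->
  (forall j, (z + (d j)%:C) * u j = \sum_i u i * (E i j)%:R) ->
  (exists i, u i != 0) -> exists j, normc (z + (d j)%:C) <= d j.
Proof.
move=> w0 rowE zu [k uk0]; apply: contrapT => none.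
have {}none j : d j < normc (z + (d j)%:C).
  by rewrite ltNge; apply/negP => dj; apply: none; exists j.
pose N i := normc (u i).
have N0 i : 0 <= N i by exact: normc_ge0.
have Nk0 : 0 < N k.
  rewrite lt_neqAle N0 andbT eq_sym; apply: contra uk0 => /eqP Nk.
  by rewrite [u k]eq0_normc.
have colN j : normc (z + (d j)%:C) * N j <= \sum_i N i * (E i j)%:R.
  rewrite -normcM zu.
  have : forall s : seq 'I_n, normc (\sum_(i <- s) u i * (E i j)%:R) <=
      \sum_(i <- s) N i * (E i j)%:R.
    elim=> [|i s IH]; first by rewrite !big_nil normc0.
    rewrite !big_cons; apply: le_trans (le_normcD _ _) _; rewrite lerD //.
    by case: (E i j); rewrite ?mulr1 ?mulr0 // normc0.
  exact.
have : \sum_j d j * N j * w j < \sum_j d j * N j * w j; last by rewrite ltxx.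
apply: (@lt_le_trans _ _ (\sum_j normc (z + (d j)%:C) * N j * w j)).
  rewrite (bigD1 k) //= [ltRHS](bigD1 k) //= ltr_leD //.
    by rewrite ltr_pM2r // ltr_pM2r.
  by apply: ler_sum => j _; rewrite ler_pM2r // ler_wpM2r // ltW.
apply: (@le_trans _ _ (\sum_j (\sum_i N i * (E i j)%:R) * w j)).
  by apply: ler_sum => j _; rewrite ler_pM2r.
under eq_bigr do rewrite mulr_suml; rewrite exchange_big /=.
apply: ler_sum => i _; rewrite -mulrA mulrCA -rowE mulr_sumr.
by rewrite le_eqVlt; apply/orP; left; apply/eqP; apply: eq_bigr => j _; ring.
Qed.

Lemma gershgorin_disc_normsq (z : R[i]) (d delta : R) : 0 <= d <= delta ->
  normc (z + d%:C) <= d -> normsq z <= - (2 * delta * Re z).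
Proof.
move=> /andP[d0 dd] zd.
have : normsq (z + d%:C) <= d ^+ 2.
  by rewrite -normc_sqr ler_sqr ?nnegrE ?normc_ge0.
rewrite /normsq; case: z zd => a b _ /=; rewrite addr0 => H.
have H' : a ^+ 2 + b ^+ 2 <= - (2 * d * a) by nra.
have := sqr_ge0 a; have := sqr_ge0 b.
have [a0|a0] := leP a 0; nra.
Qed.

End Balanced.

(** * Perturbation of eigenpairs *)

Section EigenPerturbation.
Context {R : realType} {m : nat}.

(** The tuple ((a, b), (x, y)) stands for the left eigenvector a + i b, of Euclidean
    norm 1, with eigenvalue x + i y. Real coordinates make compactness
    available. *)
Definition real_eigenpair (M : 'M[R]_m) (X : eigentuple R m) : Prop :=
  [/\ reV X *m M = reL X *: reV X - imL X *: imV X,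
      imV X *m M = imL X *: reV X + reL X *: imV X &
      \sum_j (reV X 0 j ^+ 2 + imV X 0 j ^+ 2) = 1].

Definition eigen_residual (M : 'M[R]_m) (X : eigentuple R m) : R :=
  \sum_j (\sum_i reV X 0 i * M i j - (reL X * reV X 0 j - imL X * imV X 0 j)) ^+ 2 +
  \sum_j (\sum_i imV X 0 i * M i j - (imL X * reV X 0 j + reL X * imV X 0 j)) ^+ 2 +
  (\sum_j (reV X 0 j ^+ 2 + imV X 0 j ^+ 2) - 1) ^+ 2.

Lemma sumsq_eq0 (f : 'I_m -> R) : \sum_j f j ^+ 2 = 0 <-> forall j, f j = 0.
Proof.
split=> [/psumr_eq0P f0 j|f0]; last by rewrite big1 // => j _; rewrite f0 expr0n.
by apply/eqP; rewrite -sqrf_eq0 f0 // => k _; exact: sqr_ge0.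
Qed.

Lemma eigen_residual_eq0 M X : eigen_residual M X = 0 <-> real_eigenpair M X.
Proof.
have sum0 (f : 'I_m -> R) : 0 <= \sum_j f j ^+ 2.
  by apply: sumr_ge0 => j _; exact: sqr_ge0.
split=> [/eqP|[re im nrm]].
- rewrite paddr_eq0 ?addr_ge0 ?sqr_ge0 ?sum0 //.
  rewrite paddr_eq0 ?sum0 // => /andP[/andP[/eqP/sumsq_eq0 re /eqP/sumsq_eq0 im]].
  rewrite sqrf_eq0 subr_eq0 => /eqP nrm; split => //.
  + apply/matrixP => a j; rewrite (ord1 a); have := re j.
    by rewrite !mxE => /eqP; rewrite subr_eq0 => /eqP.
  + apply/matrixP => a j; rewrite (ord1 a); have := im j.
    by rewrite !mxE => /eqP; rewrite subr_eq0 => /eqP.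
- rewrite /eigen_residual nrm subrr expr0n addr0.
  rewrite (sumsq_eq0 _).2 ?(sumsq_eq0 _).2 ?addr0 // => j; apply/eqP;
    rewrite subr_eq0; apply/eqP.
  + by have /matrixP /(_ 0 j) := im; rewrite !mxE.
  + by have /matrixP /(_ 0 j) := re; rewrite !mxE.
Qed.

Lemma cvg_sum_ord (T : Type) (F : set_system T) (FF : Filter F)
    (f : 'I_m -> T -> R) (l : 'I_m -> R) :
  (forall i, f i @ F --> l i) -> (fun t => \sum_i f i t) @ F --> \sum_i l i.
Proof.
move=> fl; apply: cvg_big => //; exact: add_continuous.
Qed.

Lemma cvg_eigentuple (X0 : eigentuple R m) (e0 : R) (G : set_system R) (FG : Filter G) :
  G --> e0 ->
  let F := filter_prod (nbhs X0) G in
  [/\ forall j, (fun z : eigentuple R m * R => reV z.1 0 j) @ F --> reV X0 0 j,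
      forall j, (fun z : eigentuple R m * R => imV z.1 0 j) @ F --> imV X0 0 j,
      (fun z : eigentuple R m * R => reL z.1) @ F --> reL X0,
      (fun z : eigentuple R m * R => imL z.1) @ F --> imL X0 &
      (fun z : eigentuple R m * R => z.2) @ F --> e0].
Proof.
move=> Ge F.
have c1 : (fun z : eigentuple R m * R => z.1) @ F --> X0 by exact: cvg_fst.
have cV : (fun z : eigentuple R m * R => z.1.1) @ F --> X0.1.
  by apply: (cvg_comp _ _ c1); exact: cvg_fst.
have cL : (fun z : eigentuple R m * R => z.1.2) @ F --> X0.2.
  by apply: (cvg_comp _ _ c1); exact: cvg_snd.
split.
- move=> j; apply: (cvg_comp (fun z : eigentuple R m * R => z.1.1.1)
    (fun v : 'rV[R]_m => v 0 j) (G := nbhs X0.1.1)).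
    by apply: (cvg_comp _ _ cV); exact: cvg_fst.
  exact: coord_continuous.
- move=> j; apply: (cvg_comp (fun z : eigentuple R m * R => z.1.1.2)
    (fun v : 'rV[R]_m => v 0 j) (G := nbhs X0.1.2)).
    by apply: (cvg_comp _ _ cV); exact: cvg_snd.
  exact: coord_continuous.
- by apply: (cvg_comp _ _ cL); exact: cvg_fst.
- by apply: (cvg_comp _ _ cL); exact: cvg_snd.
- by apply: (cvg_trans _ Ge); exact: cvg_snd.
Qed.

Lemma cvg_eigen_residual (M N : 'M[R]_m) (X0 : eigentuple R m) (G : set_system R)
    (FG : Filter G) : G --> (0 : R) ->
  (fun z : eigentuple R m * R => eigen_residual (M + z.2 *: N) z.1)
    @ filter_prod (nbhs X0) G --> eigen_residual M X0.
Proof.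
move=> G0; have [reV_ imV_ reL_ imL_ e_] := @cvg_eigentuple X0 0 G FG G0.
have M_ i j : (fun z : eigentuple R m * R => (M + z.2 *: N) i j)
    @ filter_prod (nbhs X0) G --> M i j.
  rewrite -[M i j]addr0 -(mul0r (N i j)).
  rewrite (_ : (fun _ => _) = fun z : eigentuple R m * R => M i j + z.2 * N i j).
    by apply: cvgD; [exact: cvg_cst|apply: cvgM => //; exact: cvg_cst].
  by apply/funext => z; rewrite !mxE.
rewrite /eigen_residual.
apply: cvgD; [apply: cvgD|].
- apply: cvg_sum_ord => j; apply: cvgM; apply: cvgB.
  + by apply: cvg_sum_ord => i; apply: cvgM.
  + by apply: cvgB; apply: cvgM.
  + by apply: cvg_sum_ord => i; apply: cvgM.
  + by apply: cvgB; apply: cvgM.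
- apply: cvg_sum_ord => j; apply: cvgM; apply: cvgB.
  + by apply: cvg_sum_ord => i; apply: cvgM.
  + by apply: cvgD; apply: cvgM.
  + by apply: cvg_sum_ord => i; apply: cvgM.
  + by apply: cvgD; apply: cvgM.
- apply: cvgM; (apply: cvgB; last exact: cvg_cst);
    apply: cvg_sum_ord => i; apply: cvgD; exact: cvgM.
Qed.

Definition eigen_box (B : R) : set (eigentuple R m) :=
  ([set v : 'rV[R]_m | forall i, `[-1, 1]%classic (v 0 i)] `*`
   [set v : 'rV[R]_m | forall i, `[-1, 1]%classic (v 0 i)]) `*`
  (`[- B, B]%classic `*` `[- B, B]%classic).

Lemma eigen_box_compact B : compact (eigen_box B).
Proof.
have boxV : compact [set v : 'rV[R]_m | forall i, `[-1, 1]%classic (v 0 i)].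
  have := @rV_compact R m (fun=> `[-1, 1]%classic).
  by apply => _; exact: segment_compact.
by do 2 apply: compact_setX => //; exact: segment_compact.
Qed.

Lemma eigenpair_entries_le1 M X : real_eigenpair M X ->
  forall j, `|reV X 0 j| <= 1 /\ `|imV X 0 j| <= 1.
Proof.
move=> [_ _ nrm] j.
have : reV X 0 j ^+ 2 + imV X 0 j ^+ 2 <= 1.
  rewrite -nrm (bigD1 j) //= lerDl; apply: sumr_ge0 => k _.
  by rewrite addr_ge0 ?sqr_ge0.
have := sqr_ge0 (reV X 0 j); have := sqr_ge0 (imV X 0 j).
by rewrite -(real_normK (num_real (reV X 0 j))) -(real_normK (num_real (imV X 0 j)));
  have := normr_ge0 (reV X 0 j); have := normr_ge0 (imV X 0 j); split; nra.
Qed.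

(** Rayleigh quotient: pairing the eigenvalue equations with the eigenvector
    expresses both parts of the eigenvalue through the entries of [M]. *)
Lemma eigenvalue_bound M X : real_eigenpair M X ->
  `|reL X| <= \sum_i \sum_j 2 * `|M i j| /\ `|imL X| <= \sum_i \sum_j 2 * `|M i j|.
Proof.
move=> eigX; have le1 := eigenpair_entries_le1 eigX; case: eigX => re im nrm.
have {}re j : \sum_i reV X 0 i * M i j = reL X * reV X 0 j - imL X * imV X 0 j.
  by have /matrixP /(_ 0 j) := re; rewrite !mxE.
have {}im j : \sum_i imV X 0 i * M i j = imL X * reV X 0 j + reL X * imV X 0 j.
  by have /matrixP /(_ 0 j) := im; rewrite !mxE.
have bound (z : R) (c : 'I_m -> 'I_m -> R) :
    (forall i j, `|c i j| <= 2) -> z = \sum_j \sum_i c i j * M i j ->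
    `|z| <= \sum_i \sum_j 2 * `|M i j|.
  move=> c2 ->; rewrite exchange_big /=.
  apply: le_trans (ler_norm_sum _ _ _) _; apply: ler_sum => i _.
  apply: le_trans (ler_norm_sum _ _ _) _; apply: ler_sum => j _.
  by rewrite normrM ler_wpM2r.
have prod1 (a b : R) : `|a| <= 1 -> `|b| <= 1 -> `|a * b| <= 1.
  by move=> a1 b1; rewrite normrM mulr_ile1.
split.
- apply: (bound _ (fun i j => reV X 0 i * reV X 0 j + imV X 0 i * imV X 0 j)).
    move=> i j; have [? ?] := le1 i; have [? ?] := le1 j.
    by apply: le_trans (ler_normD _ _) _; rewrite -[2]/(1 + 1) lerD // prod1.
  rewrite -[LHS]mulr1 -nrm mulr_sumr; apply: eq_bigr => j _.
  transitivity ((\sum_i reV X 0 i * M i j) * reV X 0 j +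
                (\sum_i imV X 0 i * M i j) * imV X 0 j).
    by rewrite re im; ring.
  by rewrite !mulr_suml -big_split; apply: eq_bigr => i _ /=; ring.
- apply: (bound _ (fun i j => imV X 0 i * reV X 0 j - reV X 0 i * imV X 0 j)).
    move=> i j; have [? ?] := le1 i; have [? ?] := le1 j.
    by apply: le_trans (ler_normB _ _) _; rewrite -[2]/(1 + 1) lerD // prod1.
  rewrite -[LHS]mulr1 -nrm mulr_sumr; apply: eq_bigr => j _.
  transitivity ((\sum_i imV X 0 i * M i j) * reV X 0 j -
                (\sum_i reV X 0 i * M i j) * imV X 0 j).
    by rewrite re im; ring.
  by rewrite !mulr_suml -sumrB; apply: eq_bigr => i _ /=; ring.
Qed.

(** Being an eigenpair is a closed condition, so the hypothesis is a local statement
    at every point of the compact box that contains all eigenpairs for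
    [0 < e <= 1]; compactness makes the neighbourhood of [e = 0] uniform. *)
Theorem eigenpair_perturbation (M N : 'M[R]_m) (Good : R -> eigentuple R m -> Prop) :
  (forall X0, real_eigenpair M X0 ->
     \forall X \near X0 & e \near 0^'+, real_eigenpair (M + e *: N) X -> Good e X) ->
  \forall e \near 0^'+, forall X, real_eigenpair (M + e *: N) X -> Good e X.
Proof.
move=> goodM.
pose B := \sum_i \sum_j 2 * (`|M i j| + `|N i j|).
have in_box e X : 0 < e <= 1 -> real_eigenpair (M + e *: N) X -> eigen_box B X.
  move=> /andP[e0 e1] eigX; have le1 := eigenpair_entries_le1 eigX.
  have [reB imB] := eigenvalue_bound eigX.
  have leB : \sum_i \sum_j 2 * `|(M + e *: N) i j| <= B.
    apply: ler_sum => i _; apply: ler_sum => j _; rewrite ler_wpM2l //.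
    rewrite !mxE; apply: le_trans (ler_normD _ _) _; rewrite lerD2l normrM.
    by rewrite gtr0_norm // ler_piMl.
  split; split.
  - by move=> i /=; rewrite in_itv /= -ler_norml; case: (le1 i).
  - by move=> i /=; rewrite in_itv /= -ler_norml; case: (le1 i).
  - by rewrite /= in_itv /= -ler_norml (le_trans reB).
  - by rewrite /= in_itv /= -ler_norml (le_trans imB).
have : \forall e \near 0^'+,
    eigen_box B `<=` (fun X => real_eigenpair (M + e *: N) X -> Good e X).
  have /compact_near_coveringP := @eigen_box_compact B; apply => X0 _.
  have [/goodM //|notX0] := pselect (real_eigenpair M X0).
  have res0 : eigen_residual M X0 != 0.
    by apply/eqP => /eigen_residual_eq0.
  have right0 : 0^'+ --> (0 : R) by exact: cvg_within.
  have res_neq0 := cvgr_neq0 _ (@cvg_eigen_residual M N X0 _ _ right0) res0.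
  have sub : [set z : eigentuple R m * R | eigen_residual (M + z.2 *: N) z.1 != 0]
      `<=` [set z | real_eigenpair (M + z.2 *: N) z.1 -> Good z.2 z.1].
    by move=> z /= /eqP res_z /eigen_residual_eq0.
  have FF : Filter (filter_prod (nbhs X0) (0^'+ : set_system R)).
    exact: filter_prod_filter.
  have {}res_neq0 := res_neq0 FF _.
  exact: (@filterS _ _ FF _ _ sub (res_neq0 _)).
move=> box; near=> e => X eigX.
suff : eigen_box B `<=` (fun X => real_eigenpair (M + e *: N) X -> Good e X).
  by apply => //; apply: (in_box e) => //; apply/andP; split; near: e;
    [exact: nbhs_right_gt|exact: nbhs_right_le].
by near: e.
Unshelve. all: by end_near. Qed.

End EigenPerturbation.

(** * Complex eigenvalues as real eigenpairs *)

Section RealEigenpairs.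
Context {R : realType} {m : nat}.
Implicit Types (A : 'M[R]_m).

Definition complex_row (a b : 'rV[R]_m) : 'rV[R[i]]_m := \row_j (a 0 j +i* b 0 j).

Lemma complex_row_mul A a b :
  complex_row a b *m complexify A = complex_row (a *m A) (b *m A).
Proof.
apply/matrixP => i j; rewrite !mxE; apply/eqP; rewrite eq_complex /=.
by apply/andP; split; rewrite raddf_sum; apply/eqP; apply: eq_bigr => k _;
  rewrite !mxE /=; ring.
Qed.

Lemma real_eigenpair_eigenvalue A X : real_eigenpair A X ->
  eigenvalue (complexify A) (reL X +i* imL X).
Proof.
move=> [re im nrm]; apply/eigenvalueP; exists (complex_row (reV X) (imV X)).
  rewrite complex_row_mul re im; apply/matrixP => i j; rewrite !mxE.
  by apply/eqP; rewrite eq_complex /=; apply/andP; split; apply/eqP; ring.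
apply/eqP => /matrixP /(_ 0) u0; move: nrm => /eqP; rewrite big1 ?(eq_sym 0) ?oner_eq0 //.
by move=> j _; have := u0 j; rewrite !mxE => -[-> ->]; rewrite expr0n addr0.
Qed.

Lemma eigenvalue_real_eigenpair A z : eigenvalue (complexify A) z ->
  exists2 X, real_eigenpair A X & z = reL X +i* imL X.
Proof.
move=> /eigenvalueP[u uA u0].
pose a : 'rV[R]_m := \row_j Re (u 0 j); pose b : 'rV[R]_m := \row_j Im (u 0 j).
have uE : u = complex_row a b.
  by apply/matrixP => i j; rewrite (ord1 i) !mxE; case: (u 0 j).
pose s := \sum_j (a 0 j ^+ 2 + b 0 j ^+ 2).
have s0 : 0 < s.
  rewrite lt_neqAle eq_sym; apply/andP; split; last first.
    by apply: sumr_ge0 => j _; rewrite addr_ge0 ?sqr_ge0.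
  apply: contra u0 => /eqP /psumr_eq0P s_eq0; apply/eqP/matrixP => i j.
  rewrite (ord1 i) !mxE.
  have /eqP := s_eq0 (fun k _ => addr_ge0 (sqr_ge0 _) (sqr_ge0 _)) j isT.
  rewrite paddr_eq0 ?sqr_ge0 // !sqrf_eq0 !mxE => /andP[/eqP re0 /eqP im0].
  by apply/eqP; rewrite eq_complex re0 im0 !eqxx.
pose c := (Num.sqrt s)^-1.
move: uA; rewrite uE complex_row_mul => /matrixP /(_ 0) uA.
exists ((c *: a, c *: b), (Re z, Im z)); last by case: (z).
split=> /=.
- rewrite -scalemxAl !scalerA ![_ * c]mulrC -!scalerA -scalerBr; congr (_ *: _).
  apply/matrixP => i j; have := uA j; rewrite (ord1 i) !mxE.
  by case: (z) => x y [-> _] /=; ring.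
- rewrite -scalemxAl !scalerA ![_ * c]mulrC -!scalerA -scalerDr; congr (_ *: _).
  apply/matrixP => i j; have := uA j; rewrite (ord1 i) !mxE.
  by case: (z) => x y [_ ->] /=; ring.
- transitivity (c ^+ 2 * s); last first.
    by rewrite exprVn sqr_sqrtr ?mulVf ?gt_eqF // ltW.
  by rewrite mulr_sumr; apply: eq_bigr => j _; rewrite !mxE; ring.
Qed.

End RealEigenpairs.

(** * The system matrix *)

Section SystemMatrix.
Context {R : realType} {n : nat}.
Variable E : rel 'I_n.
Let din (i : 'I_n) : R := (in_degree E i)%:R.
Let dout (i : 'I_n) : R := (out_degree E i)%:R.

Lemma in_degree_sum i : \sum_j (E i j)%:R = din i.
Proof.
rewrite /din /in_degree -sum1_card natr_sum [RHS]big_mkcond /=.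
by apply: eq_bigr => j _; rewrite inE; case: (E i j).
Qed.

Lemma out_degree_sum j : \sum_i (E i j)%:R = dout j.
Proof.
rewrite /dout /out_degree -sum1_card natr_sum [RHS]big_mkcond /=.
by apply: eq_bigr => i _; rewrite inE; case: (E i j).
Qed.

Lemma degrees_le_max i : din i <= (max_degree E)%:R /\ dout i <= (max_degree E)%:R.
Proof.
have := leq_bigmax (F := fun i => maxn (in_degree E i) (out_degree E i)) i.
rewrite -/(max_degree E) geq_max => /andP[? ?].
by rewrite !ler_nat.
Qed.

Lemma mul_system_matrix (eps : R) (u : 'rV[R]_(n + n)) :
  u *m system_matrix E eps =
  row_mx ((rsubmx u - lsubmx u) *m laplacian E din)
         (eps *: (lsubmx u - rsubmx u) - rsubmx u *m laplacian E dout).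
Proof.
rewrite -{1}[u]hsubmxK mul_row_block; congr row_mx.
  by rewrite mulmxN mulmxBl addrC.
rewrite mulmxBr !mul_mx_scalar mulmxN scalerBr.
by rewrite -[RHS]addrA; congr (_ + _); rewrite addrC.
Qed.

Lemma system_matrix_affine (eps : R) :
  system_matrix E eps = system_matrix E 0 + eps *: block_mx 0 1%:M 0 (- 1%:M).
Proof.
rewrite /system_matrix scale_block_mx add_block_mx !scaler0 !addr0.
by rewrite scalerN scale_scalar_mx mulr1 raddf0 add0r subr0.
Qed.

End SystemMatrix.

(** * Spectrum of the uncoupled system *)

Section SystemSpectrum.
Context {R : realType} {n : nat}.
Variable E : rel 'I_n.
Hypothesis n_gt0 : (0 < n)%N.
Hypothesis scE : strongly_connected E.
Let din (i : 'I_n) : R := (in_degree E i)%:R.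
Let dout (i : 'I_n) : R := (out_degree E i)%:R.
Let delta : R := (max_degree E)%:R.

Lemma in_weights : exists2 v : 'I_n -> R, (forall i, 0 < v i) & balanced E din v.
Proof.
by apply: balanced_positive_exists => // i; exact: in_degree_sum.
Qed.

Lemma out_weights : exists2 w : 'I_n -> R, (forall i, 0 < w i) &
  forall i, \sum_j (E i j)%:R * w j = dout i * w i.
Proof.
have [|||w w0 bal] := @balanced_positive_exists R n (fun i j => E j i) dout.
- by [].
- by move=> i j; rewrite (connect_rev E); exact: scE.
- by move=> i; exact: out_degree_sum.
exists w => // i; rewrite [RHS]mulrC bal; apply: eq_bigr => j _; exact: mulrC.
Qed.

Lemma balanced_out_const : balanced E dout (fun=> 1).
Proof.
move=> j; rewrite mul1r -[LHS]out_degree_sum.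
by apply: eq_bigr => i _; rewrite mul1r.
Qed.

(** The row (p j).1 + i (p j).2 is a left eigenvector of the negated Laplacian for
    the eigenvalue z.1 + i z.2. *)
Lemma laplacian_eigen_disc (d w : 'I_n -> R) (p : 'I_n -> R * R) (z : R * R) :
  (forall i, 0 <= d i <= delta) ->
  (forall i, 0 < w i) -> (forall i, \sum_j (E i j)%:R * w j = d i * w i) ->
  (forall j, - ((p j).1 * d j - \sum_i (p i).1 * (E i j)%:R) =
     z.1 * (p j).1 - z.2 * (p j).2) ->
  (forall j, - ((p j).2 * d j - \sum_i (p i).2 * (E i j)%:R) =
     z.2 * (p j).1 + z.1 * (p j).2) ->
  (exists j, p j != 0) ->
  normsq (z.1 +i* z.2) <= - (2 * delta * z.1).
Proof.
move=> dd w0 rowE re im [k pk].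
have [j le_dj] : exists j, normc ((z.1 +i* z.2) + (d j)%:C) <= d j.
  apply: (@gershgorin_weighted R n E d w _ (fun i => (p i).1 +i* (p i).2)) => //.
  - move=> j; apply/eqP; rewrite eq_complex !raddf_sum.
    have ReE i : Re (((p i).1 +i* (p i).2) * (E i j)%:R) = (p i).1 * (E i j)%:R.
      by case: (E i j); rewrite ?mulr1 ?mulr0.
    have ImE i : Im (((p i).1 +i* (p i).2) * (E i j)%:R) = (p i).2 * (E i j)%:R.
      by case: (E i j); rewrite ?mulr1 ?mulr0.
    rewrite (eq_bigr _ (fun i _ => ReE i)) (eq_bigr _ (fun i _ => ImE i)).
    by apply/andP; split; apply/eqP => /=; have := re j; have := im j; lra.
  - exists k; apply: contra pk => /eqP[pk1 pk2].
    by rewrite [p k]surjective_pairing pk1 pk2.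
exact: gershgorin_disc_normsq (dd j) le_dj.
Qed.

(** For [eps = 0] the matrix is block triangular: a left eigenvector (p, q) restricts
    to an eigenvector q of the negated out-Laplacian, and if [q = 0] then p is one
    of the negated in-Laplacian. *)
Lemma uncoupled_eigen_disc X : real_eigenpair (system_matrix E (0 : R)) X ->
  normsq (reL X +i* imL X) <= - (2 * delta * reL X).
Proof.
case: X => [[a b] [x y]] [/= re im nrm].
have degs i : 0 <= din i <= delta /\ 0 <= dout i <= delta.
  by have [? ?] := @degrees_le_max R n E i; rewrite !ler0n.
have out_eq (u r : 'rV[R]_(n + n)) : u *m system_matrix E (0 : R) = r ->
    forall j, - (rsubmx u 0 j * dout j - \sum_i rsubmx u 0 i * (E i j)%:R) =
    rsubmx r 0 j.
  move=> <- j; rewrite mul_system_matrix row_mxKr scale0r sub0r [RHS]mxE.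
  by rewrite mul_laplacian.
have in_eq (u r : 'rV[R]_(n + n)) : u *m system_matrix E (0 : R) = r ->
    rsubmx u = 0 ->
    forall j, - (lsubmx u 0 j * din j - \sum_i lsubmx u 0 i * (E i j)%:R) =
    lsubmx r 0 j.
  move=> <- u0 j; rewrite mul_system_matrix row_mxKl u0 sub0r mulNmx [RHS]mxE.
  by rewrite mul_laplacian.
have [q0|q_neq0] := pselect (forall j, rsubmx a 0 j = 0 /\ rsubmx b 0 j = 0).
- have a0 : rsubmx a = 0.
    by apply/matrixP => i j; rewrite (ord1 i) [RHS]mxE; case: (q0 j).
  have b0 : rsubmx b = 0.
    by apply/matrixP => i j; rewrite (ord1 i) [RHS]mxE; case: (q0 j).
  apply: (@laplacian_eigen_disc din (fun=> 1)
    (fun j => (lsubmx a 0 j, lsubmx b 0 j)) (x, y)) => //=.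
  + by move=> i; case: (degs i).
  + move=> i; rewrite mulr1 -[RHS]in_degree_sum.
    by apply: eq_bigr => j _; rewrite mulr1.
  + by move=> j; rewrite (in_eq _ _ re) // !mxE.
  + by move=> j; rewrite (in_eq _ _ im) // !mxE.
  + apply: contrapT => none.
    have p0 j : lsubmx a 0 j = 0 /\ lsubmx b 0 j = 0.
      have [/eqP[-> ->] //|p_neq0] := boolP ((lsubmx a 0 j, lsubmx b 0 j) == 0 :> R * R).
      by case: none; exists j.
    move: nrm => /eqP; rewrite big_split_ord /= !big1 ?addr0 ?(eq_sym 0) ?oner_eq0 //.
    * move=> j _; have [p1 p2] := q0 j; move: p1 p2; rewrite !mxE => -> ->.
      by rewrite expr0n addr0.
    * move=> j _; have [p1 p2] := p0 j; move: p1 p2; rewrite !mxE => -> ->.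
      by rewrite expr0n addr0.
- have [w w0 rowE] := out_weights.
  apply: (@laplacian_eigen_disc dout w
    (fun j => (rsubmx a 0 j, rsubmx b 0 j)) (x, y)) => //=.
  + by move=> i; case: (degs i).
  + by move=> j; rewrite (out_eq _ _ re) !mxE.
  + by move=> j; rewrite (out_eq _ _ im) !mxE.
  + apply: contrapT => none; apply: q_neq0 => j.
    have [/eqP[-> ->] //|p_neq0] := boolP ((rsubmx a 0 j, rsubmx b 0 j) == 0 :> R * R).
    by case: none; exists j.
Qed.

Lemma uncoupled_margin (lambda3 : R[i]) X :
  is_rightmost_nonnull_eigenvalue (system_matrix E (0 : R)) lambda3 ->
  0 < delta ->
  real_eigenpair (system_matrix E (0 : R)) X -> reL X +i* imL X != 0 ->
  stability_margin (tau_tilde E lambda3) (reL X +i* imL X).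
Proof.
move=> [eig3 l3 rightmost] d0 eigX X0.
have [X3 eigX3 l3E] := eigenvalue_real_eigenpair eig3.
have Re3 : Re lambda3 <= 0.
  have := le_trans (normsq_ge0 _) (uncoupled_eigen_disc eigX3).
  by rewrite l3E /= -mulrN pmulr_rge0 ?mulr_gt0 // oppr_ge0.
apply: gershgorin_margin => //.
- exact: uncoupled_eigen_disc.
- rewrite ler0_norm // lerN2.
  exact: (rightmost _ (real_eigenpair_eigenvalue eigX) X0).
Qed.

End SystemSpectrum.

(** * Eigenvalues of the weakly coupled system *)

Section NearNull.
Context {R : realType} {n : nat}.
Variable E : rel 'I_n.
Hypothesis n_gt0 : (0 < n)%N.
Hypothesis scE : strongly_connected E.
Let din (i : 'I_n) : R := (in_degree E i)%:R.
Let dout (i : 'I_n) : R := (out_degree E i)%:R.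
Variables v w : 'I_n -> R.
Hypothesis v_gt0 : forall i, 0 < v i.
Hypothesis w_gt0 : forall i, 0 < w i.
Hypothesis v_balanced : balanced E din v.
Hypothesis w_null : forall i, \sum_j (E i j)%:R * w j = dout i * w i.

Lemma dot_out_laplacian (q : 'rV[R]_n) :
  \sum_j (q *m laplacian E dout) 0 j * w j = 0.
Proof.
under eq_bigr do rewrite mul_laplacian mulrBl mulr_suml.
rewrite sumrB exchange_big /= -sumrB big1 // => j _.
apply/eqP; rewrite subr_eq0; apply/eqP; rewrite -mulrA -w_null mulr_sumr.
by apply: eq_bigr => i _; rewrite mulrA.
Qed.

(** Pairing the second block of the null equation with [w] removes the out-Laplacian
    and leaves [eps gamma (v w) = 0]. Thus the left kernel is two-dimensional for
    [eps = 0] and reduces to the constant rows for [eps > 0]. *)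
Lemma left_null_split (eps : R) (u : 'rV[R]_(n + n)) : 0 <= eps ->
  u *m system_matrix E eps = 0 ->
  exists gamma sigma, [/\ eps * gamma = 0, forall j, rsubmx u 0 j = sigma
    & forall j, rsubmx u 0 j - lsubmx u 0 j = gamma * v j].
Proof.
move=> eps0; rewrite mul_system_matrix -row_mx0 => /eq_row_mx[inE outE].
have [gamma gammaE] := balanced_proportional scE v_balanced v_gt0 (mul_laplacian_eq0 inE).
have lE j : u 0 (lshift n j) = u 0 (rshift n j) - gamma * v j.
  by have := gammaE j; rewrite !mxE => <-; ring.
have eps_gamma : eps * gamma = 0.
  pose r := eps *: (lsubmx u - rsubmx u) - rsubmx u *m laplacian E dout.
  have : \sum_j r 0 j * w j = 0.
    have -> : r = 0 by exact: outE.
    by rewrite big1 // => j _; rewrite mxE mul0r.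
  have -> : \sum_j r 0 j * w j = - (eps * gamma) * \sum_j v j * w j.
    transitivity (\sum_j - (eps * gamma) * (v j * w j) -
        \sum_j (rsubmx u *m laplacian E dout) 0 j * w j).
      rewrite -sumrB; apply: eq_bigr => j _.
      by rewrite /r [X in X * w j]mxE mulrDl [X in _ + X * _]mxE mulNr; congr (_ - _);
        rewrite !mxE lE; ring.
    by rewrite dot_out_laplacian subr0 mulr_sumr.
  move/eqP; rewrite mulf_eq0 oppr_eq0 => /orP[/eqP //|/eqP].
  move/psumr_eq0P => /(_ (fun j _ => mulr_ge0 (ltW (v_gt0 j)) (ltW (w_gt0 j)))).
  move=> /(_ (Ordinal n_gt0) isT) /eqP.
  by rewrite gt_eqF // mulr_gt0.
have out0 : rsubmx u *m laplacian E dout = 0.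
  move: outE; suff -> : eps *: (lsubmx u - rsubmx u) = 0.
    by rewrite sub0r => /eqP; rewrite oppr_eq0 => /eqP.
  apply/matrixP => i j; rewrite (ord1 i) !mxE lE.
  have -> : eps * (u 0 (rshift n j) - gamma * v j - u 0 (rshift n j)) =
    - (eps * gamma * v j) by ring.
  by rewrite eps_gamma mul0r oppr0.
have [|sigma sigmaE] := balanced_proportional scE
  (@balanced_out_const R n E) _ (mul_laplacian_eq0 out0).
  by move=> i; exact: ltr01.
exists gamma, sigma; split=> // j; first by rewrite sigmaE mulr1.
by rewrite -gammaE !mxE.
Qed.

(** The relation [e c = mu d] between complex numbers determines [mu = a + i b]:
    [Re mu |d|^2 = e Re (c conj d)] and [|mu|^2 |d|^2 = e^2 |c|^2]. If
    [Re (c conj d)] stays negative, then for small [e] the second is negligible. *)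
Lemma near_null_margin (T e a b c1 c2 d1 d2 : R) : 0 < T -> 0 < e ->
  e * c1 = a * d1 - b * d2 -> e * c2 = b * d1 + a * d2 ->
  0 < d1 ^+ 2 + d2 ^+ 2 ->
  e * (c1 ^+ 2 + c2 ^+ 2) * T + (c1 * d1 + c2 * d2) < 0 ->
  e ^+ 2 * (c1 ^+ 2 + c2 ^+ 2) * T ^+ 2 - 2 * (d1 ^+ 2 + d2 ^+ 2) < 0 ->
  stability_margin T (a +i* b).
Proof.
move=> T0 e0 ec1 ec2; set D := d1 ^+ 2 + d2 ^+ 2; set S := c1 ^+ 2 + c2 ^+ 2.
set P := c1 * d1 + c2 * d2 => D0 lt1 lt2.
have Da : D * a = e * P by rewrite /P mulrDr !mulrA ec1 ec2 /D; ring.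
have DL : D * (a ^+ 2 + b ^+ 2) = e ^+ 2 * S.
  transitivity ((e * c1) ^+ 2 + (e * c2) ^+ 2); last by rewrite /S; ring.
  by rewrite ec1 ec2 /D; ring.
rewrite /stability_margin /normsq /=; set L := a ^+ 2 + b ^+ 2 in DL *.
have L0 : 0 <= L by rewrite addr_ge0 ?sqr_ge0.
split.
  rewrite -(ltr_pM2l D0) mulrA DL -subr_lt0 [D * 2]mulrC; exact: lt2.
apply: (@le_lt_trans _ _ (L * T)).
  by rewrite ler_piMr ?mulr_ge0 ?(ltW T0) // gerBl divr_ge0 // mulr_ge0 ?sqr_ge0.
rewrite -(ltr_pM2l D0) mulrA DL mulrN Da -subr_lt0 opprK.
have -> : e ^+ 2 * S * T + e * P = e * (e * S * T + P) by ring.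
by rewrite pmulr_rlt0.
Qed.

(** The first half of every left eigenvector with nonzero eigenvalue sums to 0,
    because (1, 0) is in the right kernel. Unlike the eigenvalue being nonzero,
    this condition passes to the limit [eps = 0]. *)
Definition nonnull_margin (T : R) (X : eigentuple R (n + n)) : Prop :=
  \sum_j lsubmx (reV X) 0 j = 0 -> \sum_j lsubmx (imV X) 0 j = 0 ->
  reL X +i* imL X != 0 -> stability_margin T (reL X +i* imL X).

Lemma balanced_pairing (eps : R) (u r : 'rV[R]_(n + n)) :
  u *m system_matrix E eps = r ->
  eps * (\sum_j (u 0 (lshift n j) - u 0 (rshift n j)) * w j) =
  \sum_j r 0 (rshift n j) * w j.
Proof.
move=> <-; rewrite mul_system_matrix mulr_sumr.
transitivity (\sum_j eps * ((u 0 (lshift n j) - u 0 (rshift n j)) * w j) -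
    \sum_j (rsubmx u *m laplacian E dout) 0 j * w j).
  by rewrite dot_out_laplacian subr0.
rewrite -sumrB; apply: eq_bigr => j _; rewrite row_mxEr !mxE; ring.
Qed.

(** At an eigenpair for the eigenvalue 0, the left eigenvector (p, q) satisfies
    [q - p = g v] and [q = s] (constant), with complex [g = g1 + i g2] and
    [s = s1 + i s2]. The vanishing sum of p gives [n s = g (sum v)], hence [s = k g]
    with [k > 0]. So [g] is not zero, and [(p - q) w] and [q w] tend to real
    multiples of [g] of opposite signs. *)
Lemma near_uncoupled (T : R) (X0 : eigentuple R (n + n)) : 0 < T ->
  real_eigenpair (system_matrix E 0) X0 ->
  (reL X0 +i* imL X0 != 0 -> stability_margin T (reL X0 +i* imL X0)) ->
  \forall X \near X0 & e \near 0^'+, real_eigenpair (system_matrix E e) X ->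
    nonnull_margin T X.
Proof.
move=> T0 eigX0 marginX0.
set F := filter_prod (nbhs X0) (0^'+ : set_system R).
have FF : Filter F by exact: filter_prod_filter.
have right0 : (0^'+ : set_system R) --> (0 : R) by exact: cvg_within.
have [re_ im_ rl_ il_ e_] := @cvg_eigentuple R (n + n) X0 0 _ _ right0.
suff : \forall z \near F, real_eigenpair (system_matrix E z.2) z.1 ->
   nonnull_margin T z.1 by [].
have nonzero_sum (f : eigentuple R (n + n) * R -> R) (l : R) : f @ F --> l -> l != 0 ->
    (forall z, f z != 0 -> nonnull_margin T z.1) ->
    \forall z \near F, real_eigenpair (system_matrix E z.2) z.1 -> nonnull_margin T z.1.
  move=> fl l0 vac; have f0 : \forall z \near F, f z != 0 by exact: (cvgr_neq0 _ fl l0).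
  by near=> z; move=> _; apply: vac; near: z.
(* If the sum of p is nonzero in the limit, no nearby p sums to 0. *)
have [sum_re|sum_re] := eqVneq (\sum_j reV X0 0 (lshift n j)) 0; last first.
  apply: (nonzero_sum (fun z => \sum_j reV z.1 0 (lshift n j)) _ _ sum_re).
    by apply: cvg_sum_ord => j; exact: re_.
  move=> z /eqP nz /eqP; under eq_bigr do rewrite mxE.
  by move=> /eqP.
have [sum_im|sum_im] := eqVneq (\sum_j imV X0 0 (lshift n j)) 0; last first.
  apply: (nonzero_sum (fun z => \sum_j imV z.1 0 (lshift n j)) _ _ sum_im).
    by apply: cvg_sum_ord => j; exact: im_.
  move=> z /eqP nz _ /eqP; under eq_bigr do rewrite mxE.
  by move=> /eqP.
pose L (z : eigentuple R (n + n) * R) : R := reL z.1 ^+ 2 + imL z.1 ^+ 2.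
have L_ : L @ F --> reL X0 ^+ 2 + imL X0 ^+ 2 by apply: cvgD; apply: cvgM.
have [l0|l0] := eqVneq (reL X0 +i* imL X0) 0; last first.
  have [m1 m2] := marginX0 l0; rewrite /normsq /= in m1 m2.
  have near1 : \forall z \near F, L z * T ^+ 2 < 2.
    apply: (@cvgr_lt _ _ _ _ _ ((reL X0 ^+ 2 + imL X0 ^+ 2) * T ^+ 2) _ _ m1).
    by apply: cvgM => //; exact: cvg_cst.
  have near2 : \forall z \near F,
      L z * T * (1 - L z * T ^+ 2 / 8) + reL z.1 < 0.
    rewrite -subr_lt0 opprK in m2.
    apply: (@cvgr_lt _ _ _ _ _ ((reL X0 ^+ 2 + imL X0 ^+ 2) * T *
      (1 - (reL X0 ^+ 2 + imL X0 ^+ 2) * T ^+ 2 / 8) + reL X0) _ _ m2).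
    apply: cvgD => //; apply: cvgM.
      by apply: cvgM => //; exact: cvg_cst.
    apply: cvgB; first exact: cvg_cst.
    apply: cvgM; last exact: cvg_cst.
    by apply: cvgM => //; exact: cvg_cst.
  near=> z; move=> _ _ _ _; rewrite /stability_margin /normsq /=; split.
    by have : L z * T ^+ 2 < 2 by near: z.
  rewrite -subr_lt0 opprK.
  by have : L z * T * (1 - L z * T ^+ 2 / 8) + reL z.1 < 0 by near: z.
(* From here on the limit eigenvalue is 0. *)
have [rl0 il0] : reL X0 = 0 /\ imL X0 = 0 by case: l0.
have [re im nrm] := eigX0; rewrite rl0 il0 !scale0r subr0 ?addr0 in re im.
have [g1 [s1 [_ q1 pq1]]] := left_null_split (lexx 0) re.
have [g2 [s2 [_ q2 pq2]]] := left_null_split (lexx 0) im.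
have sum_pos (f : 'I_n -> R) : (forall i, 0 < f i) -> 0 < \sum_i f i.
  move=> f0; rewrite (bigD1 (Ordinal n_gt0)) //= ltr_pwDl //.
  by apply: sumr_ge0 => i _; exact: ltW.
set V := \sum_i v i; have V0 : 0 < V by exact: sum_pos.
set W := \sum_i w i; have W0 : 0 < W by exact: sum_pos.
set A := \sum_i v i * w i.
have A0 : 0 < A by apply: sum_pos => i; rewrite mulr_gt0.
pose k := V / n%:R; have k0 : 0 < k by rewrite divr_gt0 // ltr0n.
have s_of_g (u : 'rV[R]_(n + n)) g s : (forall j, rsubmx u 0 j = s) ->
    (forall j, rsubmx u 0 j - lsubmx u 0 j = g * v j) ->
    \sum_j u 0 (lshift n j) = 0 -> s = k * g.
  move=> q pq p0.
  have : \sum_j (rsubmx u 0 j - lsubmx u 0 j) = g * V.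
    by rewrite mulr_sumr; apply: eq_bigr => j _; exact: pq.
  rewrite sumrB (eq_bigr _ (fun j _ => q j)) sumr_const card_ord.
  rewrite (eq_bigr (fun j => u 0 (lshift n j))); last by move=> j _; rewrite mxE.
  rewrite p0 subr0 -mulr_natr /k => sn.
  have n0 : n%:R != 0 :> R by rewrite pnatr_eq0 -lt0n.
  by apply: (mulIf n0); rewrite sn; field.
have s1E := s_of_g _ _ _ q1 pq1 sum_re.
have s2E := s_of_g _ _ _ q2 pq2 sum_im.
have g_pos : 0 < g1 ^+ 2 + g2 ^+ 2.
  rewrite lt_neqAle addr_ge0 ?sqr_ge0 // andbT eq_sym.
  rewrite paddr_eq0 ?sqr_ge0 // !sqrf_eq0; apply/negP => /andP[/eqP g10 /eqP g20].
  have entries0 (u : 'rV[R]_(n + n)) : (forall j, rsubmx u 0 j = 0) ->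
      (forall j, rsubmx u 0 j - lsubmx u 0 j = 0) -> forall j, u 0 j = 0.
    move=> q pq j; case: (split_ordP j) => i ->; last by rewrite -(q i) mxE.
    by have := pq i; rewrite q sub0r mxE => /eqP; rewrite oppr_eq0 => /eqP.
  have re0 := entries0 (reV X0); have im0 := entries0 (imV X0).
  move: nrm => /eqP; rewrite big1 ?(eq_sym 0) ?oner_eq0 // => j _.
  rewrite re0 ?im0 ?expr0n ?addr0 // => i.
  - by rewrite q2 s2E g20 mulr0.
  - by rewrite pq2 g20 mul0r.
  - by rewrite q1 s1E g10 mulr0.
  - by rewrite pq1 g10 mul0r.
pose c1 (z : eigentuple R (n + n) * R) : R :=
  \sum_j (reV z.1 0 (lshift n j) - reV z.1 0 (rshift n j)) * w j.
pose c2 (z : eigentuple R (n + n) * R) : R :=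
  \sum_j (imV z.1 0 (lshift n j) - imV z.1 0 (rshift n j)) * w j.
pose d1 (z : eigentuple R (n + n) * R) : R := \sum_j reV z.1 0 (rshift n j) * w j.
pose d2 (z : eigentuple R (n + n) * R) : R := \sum_j imV z.1 0 (rshift n j) * w j.
have c_lim (u : 'rV[R]_(n + n)) g :
    (forall j, rsubmx u 0 j - lsubmx u 0 j = g * v j) ->
    \sum_j (u 0 (lshift n j) - u 0 (rshift n j)) * w j = - g * A.
  move=> pq; rewrite mulr_sumr; apply: eq_bigr => j _.
  by have := pq j; rewrite !mxE mulrA mulNr => <-; rewrite opprB.
have d_lim (u : 'rV[R]_(n + n)) s : (forall j, rsubmx u 0 j = s) ->
    \sum_j u 0 (rshift n j) * w j = s * W.
  by move=> q; rewrite mulr_sumr; apply: eq_bigr => j _; rewrite -(q j) mxE.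
have c1_ : c1 @ F --> - g1 * A.
  rewrite -(c_lim _ _ pq1); apply: cvg_sum_ord => j; apply: cvgM; last exact: cvg_cst.
  exact: cvgB.
have c2_ : c2 @ F --> - g2 * A.
  rewrite -(c_lim _ _ pq2); apply: cvg_sum_ord => j; apply: cvgM; last exact: cvg_cst.
  exact: cvgB.
have d1_ : d1 @ F --> s1 * W.
  rewrite -(d_lim _ _ q1); apply: cvg_sum_ord => j; apply: cvgM => //; exact: cvg_cst.
have d2_ : d2 @ F --> s2 * W.
  rewrite -(d_lim _ _ q2); apply: cvg_sum_ord => j; apply: cvgM => //; exact: cvg_cst.
have near_e : \forall z \near F, 0 < z.2.
  have snd_ : (fun z : eigentuple R (n + n) * R => z.2) @ F --> (0^'+ : set_system R).
    exact: cvg_snd.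
  exact: (snd_ [set e | 0 < e] (nbhs_right_gt 0)).
pose D (z : eigentuple R (n + n) * R) : R := d1 z ^+ 2 + d2 z ^+ 2.
pose S (z : eigentuple R (n + n) * R) : R := c1 z ^+ 2 + c2 z ^+ 2.
pose P (z : eigentuple R (n + n) * R) : R := c1 z * d1 z + c2 z * d2 z.
have D_ : D @ F --> (s1 * W) ^+ 2 + (s2 * W) ^+ 2 by apply: cvgD; apply: cvgM.
have S_ : S @ F --> (- g1 * A) ^+ 2 + (- g2 * A) ^+ 2 by apply: cvgD; apply: cvgM.
have P_ : P @ F --> - g1 * A * (s1 * W) + - g2 * A * (s2 * W).
  by apply: cvgD; apply: cvgM.
have D_pos : 0 < (s1 * W) ^+ 2 + (s2 * W) ^+ 2.
  have -> : (s1 * W) ^+ 2 + (s2 * W) ^+ 2 = (k * W) ^+ 2 * (g1 ^+ 2 + g2 ^+ 2).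
    by rewrite s1E s2E; ring.
  by rewrite mulr_gt0 // exprn_gt0 // mulr_gt0.
have P_neg : - g1 * A * (s1 * W) + - g2 * A * (s2 * W) < 0.
  have -> : - g1 * A * (s1 * W) + - g2 * A * (s2 * W) =
      - (k * A * W * (g1 ^+ 2 + g2 ^+ 2)) by rewrite s1E s2E; ring.
  by rewrite oppr_lt0 mulr_gt0 // mulr_gt0 // mulr_gt0.
have near_D : \forall z \near F, 0 < D z by apply: (@cvgr_gt _ _ _ _ _ _ D_).
have near_P : \forall z \near F, z.2 * S z * T + P z < 0.
  have lim : (fun z => z.2 * S z * T + P z) @ F -->
     0 * ((- g1 * A) ^+ 2 + (- g2 * A) ^+ 2) * T +
       (- g1 * A * (s1 * W) + - g2 * A * (s2 * W)).
    by apply: cvgD => //; apply: cvgM; [exact: cvgM|exact: cvg_cst].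
  by apply: (@cvgr_lt _ _ _ _ _ _ lim); rewrite !mul0r add0r.
have near_S : \forall z \near F, z.2 ^+ 2 * S z * T ^+ 2 - 2 * D z < 0.
  have lim : (fun z => z.2 ^+ 2 * S z * T ^+ 2 - 2 * D z) @ F -->
     0 ^+ 2 * ((- g1 * A) ^+ 2 + (- g2 * A) ^+ 2) * T ^+ 2 -
       2 * ((s1 * W) ^+ 2 + (s2 * W) ^+ 2).
    apply: cvgB; last by apply: cvgM => //; exact: cvg_cst.
    by apply: cvgM; [apply: cvgM => //; exact: cvgM|exact: cvg_cst].
  apply: (@cvgr_lt _ _ _ _ _ _ lim).
  by rewrite expr0n !mul0r add0r oppr_lt0 mulr_gt0.
near=> z; move=> [rez imz _] _ _ _.
apply: (@near_null_margin T z.2 _ _ (c1 z) (c2 z) (d1 z) (d2 z)) => //.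
- by near: z.
- rewrite (balanced_pairing rez) /d1 /d2 !mulr_sumr -sumrB.
  by apply: eq_bigr => j _; rewrite !mxE; ring.
- rewrite (balanced_pairing imz) /d1 /d2 !mulr_sumr -big_split.
  by apply: eq_bigr => j _; rewrite !mxE /=; ring.
- by have : 0 < D z by near: z.
- by have : z.2 * S z * T + P z < 0 by near: z.
- by have : z.2 ^+ 2 * S z * T ^+ 2 - 2 * D z < 0 by near: z.
Unshelve. all: by end_near. Qed.

End NearNull.

(** * Removing the conserved mode *)

Section Deflation.
Context {R : realType} {n : nat}.
Variable E : rel 'I_n.
Hypothesis n_gt0 : (0 < n)%N.
Hypothesis scE : strongly_connected E.

Definition consensus_vec : 'cV[R]_(n + n) := col_mx (const_mx n%:R^-1) 0.
Definition total_row : 'rV[R]_(n + n) := const_mx 1.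

Lemma system_matrix_consensus (eps : R) : system_matrix E eps *m consensus_vec = 0.
Proof.
have Lin0 : laplacian E (fun i => (in_degree E i)%:R) *m
    (const_mx n%:R^-1 : 'cV[R]_n) = 0.
  have -> : const_mx n%:R^-1 = n%:R^-1 *: const_mx 1 :> 'cV[R]_n.
    by apply/matrixP => i j; rewrite !mxE mulr1.
  by rewrite -scalemxAr laplacian_col_null ?scaler0 // => i; exact: in_degree_sum.
by rewrite mul_block_col !mulmx0 !addr0 mulNmx Lin0 oppr0 col_mx0.
Qed.

Lemma total_row_system_matrix (eps : R) : total_row *m system_matrix E eps = 0.
Proof.
rewrite mul_system_matrix.
have -> : lsubmx total_row = const_mx 1 by apply/matrixP => i j; rewrite !mxE.
have -> : rsubmx total_row = const_mx 1 by apply/matrixP => i j; rewrite !mxE.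
rewrite subrr mul0mx scaler0 sub0r.
have -> : const_mx 1 *m laplacian E (fun i => (out_degree E i)%:R) = 0 :> 'rV[R]_n.
  apply/matrixP => i j; rewrite (ord1 i) mul_laplacian mxE.
  rewrite [X in X - _](@balanced_out_const R n E j) [RHS]mxE.
  by apply/eqP; rewrite subr_eq0; apply/eqP/eq_bigr => k _; rewrite mxE.
by rewrite oppr0 row_mx0.
Qed.

Lemma mul_consensus (u : 'rV[R]_(n + n)) :
  (u *m consensus_vec) 0 0 = (\sum_j lsubmx u 0 j) / n%:R.
Proof.
rewrite -{1}[u]hsubmxK mul_row_col mulmx0 addr0 mxE mulr_suml.
by apply: eq_bigr => j _; rewrite [X in _ * X]mxE.
Qed.

Lemma total_consensus : total_row *m consensus_vec = 1%:M.
Proof.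
apply/matrixP => i j; rewrite (ord1 i) (ord1 j) mul_consensus !mxE.
under eq_bigr do rewrite !mxE.
by rewrite sumr_const card_ord divff // pnatr_eq0 -lt0n.
Qed.

(** Wielandt deflation: [consensus_vec] and [total_row] are a right and a left null
    vector of [system_matrix] with product 1, so that the eigenvalue 0 becomes
    [- kappa] and the other ones do not change. *)
Definition deflated_matrix (eps kappa : R) : 'M[R]_(n + n) :=
  system_matrix E eps - kappa *: (consensus_vec *m total_row).

(** A left eigenvector either annihilates [consensus_vec], and then it is one of
    [system_matrix] whose eigenvalue is nonzero since 0 is simple, or its eigenvalue
    is [- kappa]. The choice [kappa = 1 / (2 T)] gives the margin in this case. *)
Lemma deflated_margin (eps T : R) (z : R[i]) : 0 < eps -> 0 < T ->
  (forall X, real_eigenpair (system_matrix E eps) X -> nonnull_margin T X) ->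
  eigenvalue (map_mx (real_complex R) (deflated_matrix eps (1 / (2 * T)))) z ->
  stability_margin T z.
Proof.
set kappa := 1 / (2 * T) => eps0 T0 slow.
move=> /eigenvalue_real_eigenpair[X [re im nrm] ->].
pose s (u : 'rV[R]_(n + n)) := (u *m consensus_vec) 0 0.
have sE (u : 'rV[R]_(n + n)) : u *m consensus_vec = (s u)%:M by exact: mx11_scalar.
have deflE (u : 'rV[R]_(n + n)) : u *m deflated_matrix eps kappa =
    u *m system_matrix E eps - (kappa * s u) *: total_row.
  by rewrite mulmxBr -scalemxAr mulmxA sE mul_scalar_mx scalerA.
have s_defl (u : 'rV[R]_(n + n)) : s (u *m deflated_matrix eps kappa) = - kappa * s u.
  rewrite {1}/s deflE mulmxBl -mulmxA system_matrix_consensus mulmx0 sub0r.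
  rewrite -scalemxAl total_consensus mulNr; move: (kappa * _) => c.
  by rewrite !mxE mulr1.
have s_comb (a b : R) (u1 u2 : 'rV[R]_(n + n)) :
    s (a *: u1 + b *: u2) = a * s u1 + b * s u2.
  by rewrite /s mulmxDl -!scalemxAl !mxE.
have re_s : - kappa * s (reV X) = reL X * s (reV X) - imL X * s (imV X).
  by rewrite -s_defl re -scaleNr s_comb mulNr.
have im_s : - kappa * s (imV X) = imL X * s (reV X) + reL X * s (imV X).
  by rewrite -s_defl im s_comb.
have [[s1 s2]|s_neq0] := pselect (s (reV X) = 0 /\ s (imV X) = 0).
- have eigX : real_eigenpair (system_matrix E eps) X.
    split=> //; first by rewrite -re deflE s1 mulr0 scale0r subr0.
    by rewrite -im deflE s2 mulr0 scale0r subr0.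
  have n0 : n%:R != 0 :> R by rewrite pnatr_eq0 -lt0n.
  have sum0 (u : 'rV[R]_(n + n)) : s u = 0 -> \sum_j lsubmx u 0 j = 0.
    rewrite /s mul_consensus => /eqP; rewrite mulf_eq0 invr_eq0 (negPf n0) orbF.
    by move=> /eqP.
  apply: slow; rewrite ?sum0 //; apply/eqP => -[rl0 il0].
  have [v v0 balv] := @in_weights R n E n_gt0 scE.
  have [w w0 wnull] := @out_weights R n E n_gt0 scE.
  have null0 (u : 'rV[R]_(n + n)) : s u = 0 -> u *m system_matrix E eps = 0 ->
      forall j, u 0 j = 0.
    move=> su uM.
    have [g [c [epsg cE gE]]] := left_null_split n_gt0 scE v0 w0 balv wnull (ltW eps0) uM.
    have g0 : g = 0 by move/eqP: epsg; rewrite mulf_eq0 gt_eqF //= => /eqP.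
    have lE j : lsubmx u 0 j = c.
      by apply/eqP; rewrite eq_sym -subr_eq0 -(cE j) gE g0 mul0r.
    have c0 : c = 0.
      move: (sum0 u su); rewrite (eq_bigr _ (fun j _ => lE j)) sumr_const card_ord.
      by rewrite -mulr_natr => /eqP; rewrite mulf_eq0 (negPf n0) orbF => /eqP.
    move=> j; case: (split_ordP j) => i ->.
      by have := lE i; rewrite mxE c0.
    by have := cE i; rewrite mxE c0.
  case: eigX => re' im' _; rewrite rl0 il0 !scale0r ?subr0 ?addr0 in re' im'.
  move: nrm => /eqP; rewrite big1 ?(eq_sym 0) ?oner_eq0 // => j _.
  by rewrite (null0 _ s1 re') (null0 _ s2 im') expr0n addr0.
- have s_pos : 0 < s (reV X) ^+ 2 + s (imV X) ^+ 2.
    rewrite lt_neqAle addr_ge0 ?sqr_ge0 // andbT eq_sym.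
    rewrite paddr_eq0 ?sqr_ge0 // !sqrf_eq0; apply/negP => /andP[/eqP s1 /eqP s2].
    exact: s_neq0.
  have /eqP : ((reL X + kappa) ^+ 2 + imL X ^+ 2) *
      (s (reV X) ^+ 2 + s (imV X) ^+ 2) = 0.
    transitivity (((reL X + kappa) * s (reV X) - imL X * s (imV X)) ^+ 2 +
        (imL X * s (reV X) + (reL X + kappa) * s (imV X)) ^+ 2); first by ring.
    have -> : (reL X + kappa) * s (reV X) - imL X * s (imV X) = 0 by lra.
    have -> : imL X * s (reV X) + (reL X + kappa) * s (imV X) = 0 by lra.
    by rewrite expr0n addr0.
  rewrite mulf_eq0 (gt_eqF s_pos) orbF paddr_eq0 ?sqr_ge0 // !sqrf_eq0.
  move=> /andP[/eqP rl /eqP il].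
  have rlE : reL X = - kappa by lra.
  rewrite /stability_margin /normsq /= rlE il.
  have -> : ((- kappa) ^+ 2 + 0 ^+ 2) * T ^+ 2 = 1 / 4.
    by rewrite /kappa; field; rewrite gt_eqF.
  have -> : ((- kappa) ^+ 2 + 0 ^+ 2) * T = kappa / 2.
    by rewrite /kappa; field; rewrite gt_eqF.
  have kappa0 : 0 < kappa by rewrite divr_gt0 // mulr_gt0.
  by split; lra.
Qed.

End Deflation.

(** * Convergence to the average *)

(** The right derivative at 0 is needed for the continuity at 0 from the right, which
    links the constant total for [t > 0] to the initial condition. *)
Lemma total_conserved (R : realType) (n : nat) (E : rel 'I_n) (eps tau : R)
    (y : R -> 'cV[R]_(n + n)) :
  solves_delay_system (system_matrix E eps) tau y ->
  forall t, 0 < t -> \sum_i y t i 0 = \sum_i y 0 i 0.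
Proof.
move=> [right_der der].
pose S (t : R) : R := \sum_i y t i 0.
have S_der (t : R) : 0 < t -> is_derive t 1 S 0.
  move=> t0; have -> : 0 = \sum_i (system_matrix E eps *m y (t - tau)) i 0.
    have := congr1 (fun M => (M *m y (t - tau)) 0 0) (@total_row_system_matrix R n E eps).
    rewrite mul0mx -mulmxA [LHS]mxE [RHS]mxE => sum0; rewrite -[LHS]sum0.
    by apply: eq_bigr => i _; rewrite [X in X * _]mxE mul1r.
  have -> : S = \sum_i (fun s => y s i 0) by apply/funext => s; rewrite fct_sumE.
  by apply: is_derive_sum => i; apply: is_derive_coord; exact: der.
have S_const (t s : R) : 0 < t -> t <= s -> S s = S t.
  move=> t0 ts; have [||c _ /eqP] := @MVT_segment R S (fun=> 0) t s ts.
  - by move=> r /[!in_itv]/= /andP[tr _]; apply: S_der; exact: lt_trans tr.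
  - apply: derivable_within_continuous => r /[!in_itv]/= /andP[tr _].
    by have [] := S_der r (lt_le_trans t0 tr).
  by rewrite mul0r subr_eq0 => /eqP.
have y_right i : y h i 0 @[h --> 0^'+] --> y 0 i 0.
  have quot : h^-1 * (y h i 0 - y 0 i 0) @[h --> 0^'+] -->
      (system_matrix E eps *m y (- tau)) i 0.
    have := cvg_comp _ _ right_der
      (@coord_continuous R _ _ i 0 (system_matrix E eps *m y (- tau))).
    move=> quot; apply: cvg_trans quot; apply: near_eq_cvg; near=> h.
    by rewrite /= !mxE.
  have id0 : h @[h --> (0 : R)^'+] --> (0 : R) by exact: cvg_within.
  have prod : h * (h^-1 * (y h i 0 - y 0 i 0)) + y 0 i 0 @[h --> 0^'+] -->
      0 * (system_matrix E eps *m y (- tau)) i 0 + y 0 i 0.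
    by apply: cvgD; [exact: cvgM|exact: cvg_cst].
  rewrite mul0r add0r in prod; apply: cvg_trans prod; apply: near_eq_cvg.
  have : \forall h \near (0 : R)^'+, 0 < h by exact: nbhs_right_gt.
  apply: filterS => h h0.
  by rewrite mulrA mulfV ?mul1r ?subrK // gt_eqF.
have S_right : S h @[h --> 0^'+] --> S 0.
  by apply: cvg_sum_ord => i; exact: y_right.
move=> t t0; rewrite -/(S t) -/(S 0).
have S_t : S h @[h --> 0^'+] --> S t.
  apply: cvg_near_cst; near=> h; symmetry; apply: S_const.
    by near: h; exact: nbhs_right_gt.
  by near: h; exact: nbhs_right_le.
exact: cvg_unique S_t S_right.
Unshelve. all: by end_near. Qed.

Lemma cvg_mx_coord (R : realType) (T : Type) (F : set_system T) (FF : Filter F)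
    p q (f : T -> 'M[R]_(p, q)) (l : 'M[R]_(p, q)) :
  (forall i j, f t i j @[t --> F] --> l i j) -> f t @[t --> F] --> l.
Proof.
move=> fl; apply/cvgrPdist_le => /= e e0; near=> t.
rewrite /Num.Def.normr/= mx_normrE (bigmax_le _ (ltW e0))//= => i _.
rewrite !mxE/=; move: i; near: t; apply: filter_forall => /= i.
exact: ((cvgrPdist_le _ _).1 (fl i.1 i.2)).
Unshelve. all: by end_near. Qed.

Theorem theorem2 (R : realType) (n : nat) (hn : (2 <= n)%N) (E : rel 'I_n)
    (hE : strongly_connected E) (lambda3 : R[i])
    (hlambda3 :
      is_rightmost_nonnull_eigenvalue (system_matrix E (0 : R)) lambda3) :
  exists2 eps_tilde : R, 0 < eps_tilde &
    forall eps : R, 0 < eps -> eps <= eps_tilde ->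
    forall tau : R, 0 < tau -> tau < tau_tilde E lambda3 ->
    forall (x0 : 'cV[R]_n) (x z : R -> 'cV[R]_n),
      (forall theta : R, - tau <= theta -> theta <= 0 ->
         x theta = x0 /\ z theta = 0) ->
      solves_delay_system (system_matrix E eps) tau
        (fun t => col_mx (x t) (z t)) ->
      x t @[t --> +oo] --> ((\sum_(i < n) x0 i 0) / n%:R) *: const_mx 1.
Proof.
have n_gt0 : (0 < n)%N by exact: leq_trans hn.
set T := tau_tilde E lambda3.
have [T0|T0] := leP T 0.
  exists 1 => // eps _ _ tau tau0 tauT.
  by have := lt_trans tau0 (lt_le_trans tauT T0); rewrite ltxx.
have delta0 : 0 < (max_degree E)%:R :> R.
  rewrite ltr0n lt0n; apply: contraL T0 => /eqP delta0.
  by rewrite /T /tau_tilde delta0 mulr0 invr0 mulr0 mul0r ltxx.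
have [v v0 balv] := @in_weights R n E n_gt0 hE.
have [w w0 wnull] := @out_weights R n E n_gt0 hE.
pose N : 'M[R]_(n + n) := block_mx 0 1%:M 0 (- 1%:M).
have slow : \forall e \near (0 : R)^'+, forall X,
    real_eigenpair (system_matrix E 0 + e *: N) X -> nonnull_margin T X.
  apply: (@eigenpair_perturbation _ _ _ _ (fun _ X => nonnull_margin T X)) => X0 eigX0.
  have near_unc := @near_uncoupled R n E n_gt0 hE v w v0 w0 balv wnull T X0 T0 eigX0
    (uncoupled_margin n_gt0 hE hlambda3 delta0 eigX0).
  set F := filter_prod (nbhs X0) ((0 : R)^'+ : set_system R).
  have FF : Filter F by exact: filter_prod_filter.
  have sub : [set X | real_eigenpair (system_matrix E X.2) X.1 -> nonnull_margin T X.1]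
      `<=` [set X | real_eigenpair (system_matrix E 0 + X.2 *: N) X.1 ->
                    nonnull_margin T X.1].
    by move=> X; rewrite /= -system_matrix_affine.
  exact: (@filterS _ F FF _ _ sub near_unc).
have [e_max /= e_max0 slow_max] := slow.
(* The neighbourhood contains only e < e_max, but eps_tilde must be admissible. *)
exists (e_max / 2); first by rewrite divr_gt0.
move=> eps eps0 eps_le tau tau0 tauT x0 x z init sol.
have {slow slow_max}slow X :
    real_eigenpair (system_matrix E eps) X -> nonnull_margin T X.
  rewrite system_matrix_affine; apply: slow_max => //=.
  rewrite sub0r normrN gtr0_norm //; apply: le_lt_trans eps_le _.
  by rewrite ltr_pdivrMr // ltr_pMr // ltr1n.
set c := \sum_i x0 i 0.
set y := fun t => col_mx (x t) (z t) in sol.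
have total_y (t : R) : - tau <= t -> \sum_i y t i 0 = c.
  have y0 s : - tau <= s -> s <= 0 -> \sum_i y s i 0 = c.
    move=> s1 s2; have [xs zs] := init s s1 s2; rewrite /y xs zs big_split_ord /=.
    rewrite [X in _ + X]big1 ?addr0; last by move=> i _; rewrite col_mxEd mxE.
    by apply: eq_bigr => i _; rewrite col_mxEu.
  move=> tau_t; have [t0|t0] := leP t 0; first exact: y0.
  by rewrite (total_conserved sol t0) y0 // oppr_le0 ltW.
set A := deflated_matrix E eps (1 / (2 * T)).
pose d (t : R) : 'cV[R]_(n + n) := y t - c *: consensus_vec.
have total_d (t : R) : - tau <= t -> total_row *m d t = 0.
  move=> tau_t; rewrite mulmxBr -scalemxAr total_consensus //.
  apply/matrixP => i j; rewrite (ord1 i) (ord1 j) !mxE mulr1.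
  rewrite (eq_bigr (fun k => y t k 0)); last by move=> k _; rewrite mxE mul1r.
  by rewrite total_y // subrr.
have d_delay (t : R) : 0 < t -> is_derive t 1 d (A *m d (t - tau)).
  move=> t0; have y_der := sol.2 t t0.
  have -> : A *m d (t - tau) = system_matrix E eps *m y (t - tau) - 0.
    rewrite /A /deflated_matrix mulmxBl -scalemxAl -mulmxA total_d; last first.
      by rewrite lerBrDr addNr ltW.
    rewrite mulmx0 scaler0 /d mulmxBr -scalemxAr system_matrix_consensus.
    by rewrite scaler0 subr0.
  exact: is_deriveB.
have d0 i : d t i 0 @[t --> +oo] --> (0 : R).
  apply: (@delay_system_decay R _ A tau 0 d) => // mu eig_mu.
  apply: (stability_margin_delay_stable tau0 (ltW tauT)).
  exact: (deflated_margin n_gt0 hE eps0 T0 slow eig_mu).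
apply: cvg_mx_coord => i j; rewrite (ord1 j) !mxE mulr1.
have -> : (fun t => x t i 0) = (fun t => d t (lshift n i) 0 + c / n%:R).
  have consE : consensus_vec (lshift n i) 0 = n%:R^-1 :> R.
    by rewrite /consensus_vec col_mxEu mxE.
  have yE t : y t (lshift n i) 0 = x t i 0 by rewrite /y col_mxEu.
  apply/funext => t; rewrite -yE [X in _ = X + _]mxE [X in _ = _ + X + _]mxE.
  by rewrite [X in _ = _ - X + _]mxE consE subrK.
rewrite -[X in _ --> X]add0r; apply: cvgD; [exact: d0|exact: cvg_cst].
Unshelve. all: by end_near. Qed.
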